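(* Let $(X,d)$ be a geodesic length space, $I\subseteq\mathbb{R}$ an open interval, $f:I\to(0,\infty)$ smooth and $Y=I\times_f X$. If $Y$ has timelike curvature bounded below (respectively above) by $K\in\mathbb{R}$, then $f$ is $K$-concave (respectively $K$-convex), i.e., $f''-Kf\le0$ (respectively $f''-Kf\ge0$) on $I$.
   Context: $Y=I\times X$ with metric $D((t,x),(t',x'))=|t-t'|+d(x,x')$; a curve $\gamma=(\alpha,\beta)$ is causal if $D$-absolutely continuous, $\alpha$ strictly monotone and $-\dot\alpha^2+(f\circ\alpha)^2v_\beta^2\le0$ a.e. ($v_\beta$ the metric derivative; timelike if $<0$ a.e.), future directed if $\dot\alpha>0$ a.e.; $L(\gamma)=\int\sqrt{\dot\alpha^2-(f\circ\alpha)^2v_\beta^2}$; $\tau(y,y')$ is the supremum of $L$ over future directed causal curves from $y$ to $y'$ ($0$ if none); $\ll,\le$ are defined by existence of future directed timelike/causal curves. Timelike curvature bounded below (above) by $K$: every point has a neighborhood $U$ with $\tau|_{U\times U}$ finite and continuous, any $x\ll y$ in $U$ joined by a causal curve in $U$ of $\tau$-length $\tau(x,y)$, and such that for every timelike geodesic triangle $(x,y,z)$ in $U$ ($x\ll y\ll z$, $\tau(x,z)<\infty$, sides realized by maximal causal curves, satisfying the size bounds needed for a comparison triangle in the two-dimensional Lorentzian model space $\mathbb{L}^2(K)$ of constant curvature $K$), and points $p,q$ on its sides with corresponding points $p',q'$ on the comparison triangle, $\tau(p,q)\le\tau_{\mathbb{L}^2(K)}(p',q')$ (respectively $\ge$)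.
   Formalization: X is assumed to have at least two points: if X is a single point, the time separation on Y does not depend on f, every timelike curvature bound holds, and the claim fails (e.g. f(t)=e^t with curvature bounded below by K=0). *)

(* Defs.v *)
From mathcomp Require Import all_boot all_order all_algebra.
From mathcomp Require Import all_classical all_reals all_analysis.
Set Implicit Arguments. Unset Strict Implicit. Unset Printing Implicit Defensive.
Import Order.TTheory GRing.Theory Num.Theory.
Import numFieldNormedType.Exports.
Local Open Scope classical_set_scope.
Local Open Scope ring_scope.

Definition is_metric (R : realType) (X : Type) (d : X -> X -> R) : Prop :=
  (forall x y, 0 <= d x y) /\ (forall x y, d x y = 0 <-> x = y) /\
  (forall x y, d x y = d y x) /\ (forall x y z, d x z <= d x y + d y z).

Definition geodesic_space (R : realType) (X : Type) (d : X -> X -> R) : Prop :=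
  forall x y : X, exists c : R -> X, c 0 = x /\ c (d x y) = y /\
    forall s t, 0 <= s <= d x y -> 0 <= t <= d x y -> d (c s) (c t) = `|s - t|.

Definition smooth_on (R : realType) (I : set R) (f : R -> R) : Prop :=
  forall (n : nat) (t : R), I t -> derivable (derive1n n f) t 1.

Section Warped.
Variables (R : realType) (X : Type) (d : X -> X -> R) (I : set R) (f : R -> R).

Definition Dist (y y' : R * X) : R := `|y.1 - y'.1| + d y.2 y'.2.

Definition mu := (@lebesgue_measure R).

Definition metric_deriv (b : R -> X) (t : R) : R :=
  lim ((fun h : R => d (b (t + h)) (b t) / `|h|) @ 0^').

(* a parametrized curve: parameter interval [s0, s1] and the map *)
Definition curveT := (R * R * (R -> R * X))%type.
Definition cs0 (g : curveT) := g.1.1.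
Definition cs1 (g : curveT) := g.1.2.
Definition cf (g : curveT) := g.2.
Definition calpha (g : curveT) := fun s => (cf g s).1.
Definition cbeta (g : curveT) := fun s => (cf g s).2.

Definition abs_cont_curve (g : curveT) : Prop :=
  exists m : R -> R, mu.-integrable `[cs0 g, cs1 g] (EFin \o m) /\
    forall s t, cs0 g <= s -> s <= t -> t <= cs1 g ->
      ((Dist (cf g s) (cf g t))%:E <= \int[mu]_(u in `[s, t]) (m u)%:E)%E.

Definition causal_char (g : curveT) (t : R) : R :=
  - (derive1 (calpha g) t) ^+ 2 + (f (calpha g t)) ^+ 2 * (metric_deriv (cbeta g) t) ^+ 2.

Definition fd_curve (tl : bool) (y y' : R * X) (g : curveT) : Prop :=
  cs0 g < cs1 g /\ cf g (cs0 g) = y /\ cf g (cs1 g) = y' /\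
  (forall s, cs0 g <= s <= cs1 g -> I (calpha g s)) /\
  abs_cont_curve g /\
  ((forall s t, cs0 g <= s -> s < t -> t <= cs1 g -> calpha g s < calpha g t) \/
   (forall s t, cs0 g <= s -> s < t -> t <= cs1 g -> calpha g t < calpha g s)) /\
  {ae mu, forall t, cs0 g <= t <= cs1 g ->
      (if tl then causal_char g t < 0 else causal_char g t <= 0)} /\
  {ae mu, forall t, cs0 g <= t <= cs1 g -> 0 < derive1 (calpha g) t}.

Definition curve_length (g : curveT) : \bar R :=
  (\int[mu]_(t in `[cs0 g, cs1 g])
     (Num.sqrt ((derive1 (calpha g) t) ^+ 2
                - (f (calpha g t)) ^+ 2 * (metric_deriv (cbeta g) t) ^+ 2))%:E)%E.

Definition tsep (y y' : R * X) : \bar R :=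
  ereal_sup ([set 0%E] `|`
             [set l | exists g, fd_curve false y y' g /\ l = curve_length g]).

Definition tl_rel (y y' : R * X) : Prop := exists g, fd_curve true y y' g.
Definition c_rel (y y' : R * X) : Prop := exists g, fd_curve false y y' g.
(* reflexive causal relation (used only to locate points on model sides) *)
Definition c_rel_refl (y y' : R * X) : Prop := y = y' \/ c_rel y y'.

Definition on_curve (g : curveT) (p : R * X) : Prop :=
  exists s, cs0 g <= s <= cs1 g /\ cf g s = p.

Definition curve_in (U : set (R * X)) (g : curveT) : Prop :=
  forall s, cs0 g <= s <= cs1 g -> U (cf g s).

Definition max_side (U : set (R * X)) (u v : R * X) (g : curveT) : Prop :=
  fd_curve false u v g /\ curve_in U g /\ curve_length g = tsep u v.

End Warped.

(* ---------- the Lorentzian model space L^2(K) ----------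
   realized as the 2-dimensional warped product J_K x_{w_K} R with
   w_K'' = K w_K:  K>0: cosh(sqrt K t) on R (universal cover of de Sitter);
   K=0: Minkowski plane; K<0: cos(sqrt(-K) t) on |t| < pi/(2 sqrt(-K))
   (the static region of anti-de Sitter). *)
Definition model_warp (R : realType) (K : R) (t : R) : R :=
  if 0 < K then (expR (Num.sqrt K * t) + expR (- (Num.sqrt K * t))) / 2
  else if K == 0 then 1 else cos (Num.sqrt (- K) * t).

Definition model_interval (R : realType) (K : R) : set R :=
  if 0 <= K then setT else [set t | `|t| < pi / (2 * Num.sqrt (- K))].

Definition model_dist (R : realType) (x y : R) : R := `|x - y|.

Definition model_pt (R : realType) (K : R) (p : R * R) : Prop := model_interval K p.1.

Definition model_tsep (R : realType) (K : R) : R * R -> R * R -> \bar R :=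
  tsep (@model_dist R) (model_interval K) (model_warp K).

Definition model_le (R : realType) (K : R) : R * R -> R * R -> Prop :=
  c_rel_refl (@model_dist R) (model_interval K) (model_warp K).

Section Curvature.
Variables (R : realType) (X : Type) (d : X -> X -> R) (I : set R) (f : R -> R).

Local Notation tau := (tsep d I f).

(* p' is the point of the model side [u', v'] corresponding to the point p
   of the side from u to v *)
Definition corr_pt (K : R) (u v : R * X) (u' v' : R * R) (p : R * X) (p' : R * R) :=
  model_pt K p' /\ model_tsep K u' p' = tau u p /\ model_tsep K p' v' = tau p v /\
  model_le K u' p' /\ model_le K p' v'.

Definition tri_pt (K : R) (x y z : R * X) (gxy gyz gxz : curveT R X)
    (x' y' z' : R * R) (p : R * X) (p' : R * R) : Prop :=
  (on_curve gxy p /\ corr_pt K x y x' y' p p') \/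
  (on_curve gyz p /\ corr_pt K y z y' z' p p') \/
  (on_curve gxz p /\ corr_pt K x z x' z' p p').

Definition tl_curv_bound (lower : bool) (K : R) : Prop :=
  forall y : R * X, I y.1 ->
  exists U : set (R * X),
    (exists r : R, 0 < r /\ forall y', I y'.1 -> Dist d y y' < r -> U y') /\
    (forall y', U y' -> I y'.1) /\
    (forall p q, U p -> U q -> tau p q \is a fin_num) /\
    (forall p q, U p -> U q -> forall e : R, 0 < e -> exists del : R, 0 < del /\
       forall p1 q1, U p1 -> U q1 -> Dist d p p1 < del -> Dist d q q1 < del ->
         `|fine (tau p q) - fine (tau p1 q1)| < e) /\
    (forall p q, U p -> U q -> tl_rel d I f p q -> exists g, max_side d I f U p q g) /\
    (forall x y z, U x -> U y -> U z -> tl_rel d I f x y -> tl_rel d I f y z ->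
       (tau x z < +oo)%E ->
       (K < 0 -> (tau x z < (pi / Num.sqrt (- K))%:E)%E) ->
       forall gxy gyz gxz,
         max_side d I f U x y gxy -> max_side d I f U y z gyz ->
         max_side d I f U x z gxz ->
       forall x' y' z' : R * R, model_pt K x' -> model_pt K y' -> model_pt K z' ->
         model_tsep K x' y' = tau x y -> model_tsep K y' z' = tau y z ->
         model_tsep K x' z' = tau x z ->
       forall p p' q q', tri_pt K x y z gxy gyz gxz x' y' z' p p' ->
         tri_pt K x y z gxy gyz gxz x' y' z' q q' ->
         if lower then (tau p q <= model_tsep K p' q')%E
         else (model_tsep K p' q' <= tau p q)%E).

End Curvature.

(* Main.v *)
Require Import Defs.
From HB Require Import structures.
From mathcomp Require Import all_boot all_order all_algebra.
From mathcomp Require Import all_classical all_reals all_analysis.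
From mathcomp Require Import measurable_realfun.
From mathcomp Require Import ring lra.
Set Implicit Arguments. Unset Strict Implicit. Unset Printing Implicit Defensive.
Import Order.TTheory GRing.Theory Num.Theory.
Import numFieldNormedType.Exports.
Local Open Scope classical_set_scope.
Local Open Scope ring_scope.

(* A causal curve from (s, x) to (t, y) is bounded in length by calibrations
   G (alpha) - c d(x, beta), and lifts of geodesics of X give matching lower bounds,
   so that with A' = f^-2 and l = d(x, y)
     tau ((s, x), (t, y)) = t - s - l^2 / (2 (A t - A s)) + o(l^2).
   Compare the triangle with vertices (t0 - T, x1), (s1, x2), (t0 + T, x1), where x2
   is at distance l from x1 and s1 makes the two short sides equal, with a triangle
   of L^2(K) which is symmetric under time reversal, and let p = (t0 - T/2, x1) be a
   point of its vertical side.  As l tends to 0 the inequality between the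
   separations of p and of the vertex (s1, x2) becomes an inequality between the cross
   ratios of the values at t0 - T, t0 - T/2, t0, t0 + T of the antiderivatives of f^-2
   and of w^-2, where w is the warping function of the model.  Since ln (1 + cross ratio)
   is the double integral of S^-2, where S (u, .) is the Jacobi field vanishing at u with
   unit slope, Sturm comparison of f'' = (f''/f) f with w'' = K w shows that this
   inequality fails if f'' - K f has the wrong sign at t0. *)

(** * Primitives and metric derivatives *)

(** Two obstacles shape the argument. An upper bound for [tau] has to hold for every absolutely
    continuous causal curve, so the length integrand is compared with the derivative of an
    absolutely continuous calibration; this needs the metric derivative to exist almost everywhere,
    hence Radon-Nikodym and Lebesgue differentiation. Moreover the curvature condition speaks only
    of model triangles whose sides match exactly, so asymptotics do not suffice to find one: in the
    model the geodesics are computed from their momentum, and an isosceles triangle leaves a single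
    unknown, found by the intermediate value theorem.

    The time displacements of the two middle vertices are unknown and have to be eliminated. The sum
    of the short sides does not contain them to second order and relates the squared horizontal
    displacements in [Y] and in the model; neither does the difference between the separations of
    the vertex from [p] and from the lowest vertex, which carries the inequality. What survives is a
    quotient of coefficients, equal to a cross ratio minus 1 and therefore independent of the choice
    of the antiderivative. Two distinct points of [X] make a nondegenerate triangle possible. *)

Section RadonNikodymPrimitive.
Variables (R : realType).
Notation mu := (@lebesgue_measure R).

Lemma density_measure (m : R -> R) :
  mu.-integrable setT (EFin \o m) -> (forall x, 0 <= m x) ->
  exists nu : {finite_measure set (measurableTypeR R) -> \bar R},
    forall A, nu A = (\int[mu]_(x in A) (m x)%:E)%E.
Proof.
move=> im m0.
pose k := fun A : set (measurableTypeR R) => (\int[mu]_(x in A) (m x)%:E)%E.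
have k0 : k set0 = 0%E by rewrite /k integral_set0.
have kge0 A : (0 <= k A)%E by apply: integral_ge0 => x _; rewrite lee_fin.
have ks : semi_sigma_additive k.
  apply: semi_sigma_additive_nng_induced => [|x]; last by rewrite lee_fin.
  exact: (measurable_int mu).
pose k1 := isMeasure.Build _ _ _ k k0 kge0 ks.
pose M : {measure set (measurableTypeR R) -> \bar R} := HB.pack k k1.
have kfin : fin_num_fun M.
  by move=> A mA; apply: integrable_fin_num => //; exact: integrableS im.
pose k2 := Measure_isFinite.Build _ _ _ M kfin.
pose N : {finite_measure set (measurableTypeR R) -> \bar R} := HB.pack k k1 k2.
by exists N.
Qed.

Lemma lebesgue_stieltjes_measure_itv (F : cumulative R R) (s t : R) : s <= t ->
  lebesgue_stieltjes_measure F `]s, t]%classic = (F t - F s)%:E.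
Proof.
move=> st; rewrite /lebesgue_stieltjes_measure /measure_extension.
by rewrite measurable_mu_extE/= ?wlength_itv_bnd//; exact: is_ocitv.
Qed.

Lemma cumulative_measure_unique (F : cumulative R R)
    (nu : {measure set (measurableTypeR R) -> \bar R}) :
  (forall s t, s <= t -> nu `]s, t]%classic = (F t - F s)%:E) ->
  forall A, measurable A -> lebesgue_stieltjes_measure F A = nu A.
Proof.
move=> nuE; apply: lebesgue_stieltjes_measure_unique => X [[s t] _ <-] /=.
have [st|ts] := leP s t; first by rewrite lebesgue_stieltjes_measure_itv ?nuE.
by rewrite set_itv_ge ?bnd_simp -?leNgt ?(ltW ts)// !measure0.
Qed.

(** Absolute continuity of the integral. It serves the right continuity that a Stieltjes measure
    requires, and later the choice of a dense point close to the start of a piece of the curve. *)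
Lemma small_Rintegral_oc (m : R -> R) (s e : R) : (forall x, 0 <= m x) ->
  mu.-integrable setT (EFin \o m) -> 0 < e ->
  exists2 dl, 0 < dl & forall s t, s <= t -> t < s + dl ->
    \int[mu]_(x in `]s, t]) m x < e.
Proof.
move=> m0 im e0; have [dl [dl0 H]] := integral_normr_continuous im e0.
exists dl => // {}s t st tdl.
have <- : \int[mu]_(z in `]s, t]) `|m z| = \int[mu]_(z in `]s, t]) m z.
  by apply: eq_Rintegral => z _; rewrite ger0_norm.
apply: H; first exact: measurable_itv.
suff : (mu `]s, t]%classic < dl%:E)%E by [].
rewrite lebesgue_measure_itv/= lte_fin; case: ifP => _; last by rewrite lte_fin.
by rewrite -EFinD lte_fin ltrBlDl.
Qed.

Lemma cumulative_of_le_integral (m g : R -> R) : (forall x, 0 <= m x) ->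
  mu.-integrable setT (EFin \o m) ->
  (forall s t, s <= t -> 0 <= g t - g s <= \int[mu]_(x in `]s, t]) m x) ->
  exists F : cumulative R R, forall x, F x = g x.
Proof.
move=> m0 im gm.
have nd : nondecreasing g.
  by move=> s t st; rewrite -subr_ge0; have /andP[] := gm _ _ st.
have rc : right_continuous g.
  move=> x; apply/cvgrPdist_lt => e e0.
  have [dl dl0 H] := small_Rintegral_oc x m0 im e0.
  near=> y.
  have xy : x <= y by near: y; exact: nbhs_right_ge.
  rewrite distrC ger0_norm ?subr_ge0 ?nd//.
  have /andP[_ /le_lt_trans] := gm _ _ xy; apply; apply: H => //.
  by near: y; apply: nbhs_right_lt; rewrite ltrDl.
pose g1 := isCumulative.Build R _ R g nd rc.
pose G : cumulative R R := HB.pack g g1.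
by exists G.
Unshelve. all: by end_near. Qed.

Lemma Rintegral_oc_split (m : R -> R) (s t : R) :
  mu.-integrable setT (EFin \o m) -> s <= t ->
  \int[mu]_(x in `]s, t]) m x =
  \int[mu]_(x in `]-oo, t]) m x - \int[mu]_(x in `]-oo, s]) m x.
Proof.
move=> im st; rewrite Rintegral_itvB ?bnd_simp//.
by apply: integrableS im.
Qed.

(* Both [int m + rho] and [int m - rho] are nondecreasing, and their Stieltjes
   measures add up to [2 m dx]; so each of them has a density. *)
Lemma primitive_of_le_integral (m rho : R -> R) : (forall x, 0 <= m x) ->
  mu.-integrable setT (EFin \o m) ->
  (forall s t, s <= t -> `|rho t - rho s| <= \int[mu]_(x in `]s, t]) m x) ->
  exists r : R -> R, mu.-integrable setT (EFin \o r) /\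
    (forall s t, s <= t -> rho t - rho s = \int[mu]_(x in `]s, t]) r x).
Proof.
move=> m0 im rm.
pose M x := \int[mu]_(y in `]-oo, x]) m y.
pose n x := m x + m x.
have n0 x : 0 <= n x by rewrite addr_ge0.
have in_ : mu.-integrable setT (EFin \o n).
  by rewrite (_ : EFin \o n = (EFin \o m) \+ (EFin \o m))%E//; exact: integrableD.
have imS A : measurable A -> mu.-integrable A (EFin \o m).
  by move=> mA; apply: integrableS im.
have nE s t : \int[mu]_(x in `]s, t]) n x =
    \int[mu]_(x in `]s, t]) m x + \int[mu]_(x in `]s, t]) m x.
  by apply: RintegralD => //; exact: imS.
have bnd s t : s <= t -> 0 <= (M t + rho t) - (M s + rho s) <= \int[mu]_(x in `]s, t]) n x
                      /\ 0 <= (M t - rho t) - (M s - rho s) <= \int[mu]_(x in `]s, t]) n x.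
  move=> st; have := rm _ _ st; rewrite nE (Rintegral_oc_split im st) -/(M s) -/(M t).
  by rewrite ler_norml => /andP[? ?]; split; apply/andP; split; lra.
have [F1 F1E] := @cumulative_of_le_integral n (fun x => M x + rho x) n0 in_
  (fun s t st => proj1 (bnd s t st)).
have [F2 F2E] := @cumulative_of_le_integral n (fun x => M x - rho x) n0 in_
  (fun s t st => proj2 (bnd s t st)).
have [F3 F3E] : exists F : cumulative R R, forall x, F x = M x + M x.
  apply: (@cumulative_of_le_integral n (fun x => M x + M x) n0 in_) => s t st.
  have := bnd _ _ st; rewrite nE (Rintegral_oc_split im st) -/(M s) -/(M t).
  by move=> [/andP[? ?] /andP[? ?]]; apply/andP; split; lra.
have [kap kapE] := density_measure in_ n0.
have kF A : measurable A -> lebesgue_stieltjes_measure F3 A = kap A.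
  apply: cumulative_measure_unique => s t st; rewrite !F3E.
  transitivity (\int[mu]_(x in `]s, t]) (n x)%:E)%E; first exact: kapE.
  transitivity (\int[mu]_(x in `]s, t]) n x)%:E.
    by rewrite /Rintegral fineK//; apply: integrable_fin_num => //; exact: integrableS in_.
  by rewrite nE (Rintegral_oc_split im st); congr EFin; rewrite /M; ring.
have kF' A : measurable A -> lebesgue_stieltjes_measure F3 A =
  (lebesgue_stieltjes_measure F1 A + lebesgue_stieltjes_measure F2 A)%E.
  move=> mA; transitivity (measure_add (lebesgue_stieltjes_measure F1)
      (lebesgue_stieltjes_measure F2) A); last exact: measure_addE.
  apply: cumulative_measure_unique mA => s t st.
  transitivity (lebesgue_stieltjes_measure F1 `]s, t]%classic +
    lebesgue_stieltjes_measure F2 `]s, t]%classic)%E; first exact: measure_addE.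
  rewrite !lebesgue_stieltjes_measure_itv// !F1E !F2E !F3E.
  by rewrite -EFinD; congr EFin; ring.
have le1 A : measurable A -> (lebesgue_stieltjes_measure F1 A <= kap A)%E.
  by move=> mA; rewrite -kF// kF'// leeDl.
have fin1 : fin_num_fun (lebesgue_stieltjes_measure F1).
  move=> A mA; rewrite ge0_fin_numE//; apply: le_lt_trans (le1 A mA) _.
  by rewrite -ge0_fin_numE//; exact: fin_num_measure.
pose k2 := Measure_isFinite.Build _ _ _ (lebesgue_stieltjes_measure F1) fin1.
pose N : {finite_measure set (measurableTypeR R) -> \bar R} :=
  HB.pack (Measure.sort (lebesgue_stieltjes_measure F1)) k2.
(* The measure of [F1] lies below [kap], which has a density. *)
have dom : N `<< mu.
  move=> A A0 B mB BA; apply/eqP; rewrite eq_le measure_ge0 andbT.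
  apply: (le_trans (le1 B mB)).
  suff: kap B = 0%E by move/eqP; rewrite eq_le => /andP[].
  rewrite kapE; apply: null_set_integral => //; last exact: A0.
  by apply: (@measurable_funS _ _ _ _ setT) => //; exact: (measurable_int mu).
have [h [h0 hfin ih hE]] := radon_nikodym_sigma_finite dom.
(* [h] is the density of [M + rho], and [m] that of [M]. *)
pose r x := fine (h x) - m x.
have ifh : mu.-integrable setT (EFin \o (fine \o h)).
  by apply: eq_integrable ih => //= x _; rewrite fineK.
exists r; split.
  rewrite (_ : EFin \o r = (EFin \o (fine \o h)) \- (EFin \o m))%E//.
  exact: integrableB.
move=> s t st.
have := hE _ (measurable_itv `]s, t]); rewrite /= lebesgue_stieltjes_measure_itv//.
rewrite !F1E => hst.
rewrite RintegralB//; [|exact: integrableS ifh|exact: imS].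
have -> : \int[mu]_(x in `]s, t]) fine (h x) = M t + rho t - (M s + rho s).
  rewrite /Rintegral; under eq_integral do rewrite fineK//.
  by rewrite -hst.
rewrite (Rintegral_oc_split im st) -/(M s) -/(M t); ring.
Qed.

End RadonNikodymPrimitive.

#[global] Instance ae_lebesgue_filter (R : realType) :
  Filter (nbhs (almost_everywhere (@lebesgue_measure R))).
Proof. exact: (ae_filter_ringOfSetsType (@lebesgue_measure R)). Qed.

(** * Almost everywhere existence of the metric derivative *)

Section MetricDerivative.
Variables (R : realType).
Notation mu := (@lebesgue_measure R).

Lemma cvg_dnbhs0P (F : R -> R) (l : R) :
  (forall e, 0 < e -> exists2 dl, 0 < dl &
     forall h, h != 0 -> `|h| < dl -> `|F h - l| <= e) <-> F @ 0^' --> l.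
Proof.
split=> [H|/cvgrPdist_le H e e0].
  apply/cvgrPdist_le => e e0; have [dl dl0 {}H] := H e e0.
  exists dl => //= h hdl h0; rewrite distrC; apply: H => //.
  by move: hdl; rewrite /ball_/= sub0r normrN.
have [dl dl0 {}H] := H e e0; exists dl => // h h0 hdl.
by rewrite distrC; apply: H => //=; rewrite /ball_/= sub0r normrN.
Qed.

(** Multiplying out by [|h|] admits [h = 0] and leaves inequalities that linear arithmetic can
    combine. *)
Lemma is_derive_epsP (f : R -> R) (x l : R) :
  is_derive x 1 f l <->
  (forall e, 0 < e -> exists2 dl, 0 < dl &
     forall h, `|h| < dl -> `|f (x + h) - f x - l * h| <= e * `|h|).
Proof.
have E h : h != 0 -> `|h^-1 *: (f (h *: 1 + x) - f x) - l| = `|f (x + h) - f x - l * h| / `|h|.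
  move=> h0; rewrite -normrV ?unitfE// -normrM; congr `| _ |.
  rewrite /GRing.scale/= mulr1 (addrC h x); field.
  by rewrite h0.
split=> [[df dfl] e e0|H].
  have : h^-1 *: (f (h *: 1 + x) - f x) @[h --> 0^'] --> l.
    by rewrite -dfl; exact: df.
  move=> /cvg_dnbhs0P/(_ e e0)[dl dl0 H]; exists dl => // h hdl.
  have [->|h0] := eqVneq h 0; first by rewrite addr0 subrr mulr0 subrr normr0 mulr0.
  by have := H h h0 hdl; rewrite E// ler_pdivrMr ?normr_gt0.
have cv : h^-1 *: (f (h *: 1 + x) - f x) @[h --> 0^'] --> l.
  apply/cvg_dnbhs0P => e e0; have [dl dl0 {}H] := H e e0; exists dl => // h h0 hdl.
  by rewrite E// ler_pdivrMr ?normr_gt0// H.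
split; first by apply/cvg_ex; exists l.
by apply/cvg_lim.
Qed.

(** [metric_deriv] is a bare [lim], meaningful only where the limit exists, so every value of it is
    obtained through this criterion. *)
Lemma metric_deriv_eq (X : Type) (d : X -> X -> R) (b : R -> X) (t v : R) :
  (forall e, 0 < e -> exists2 dl, 0 < dl &
     forall h, h != 0 -> `|h| < dl -> `|d (b (t + h)) (b t) / `|h| - v| <= e) ->
  metric_deriv d b t = v.
Proof. by move=> /cvg_dnbhs0P H; apply/cvg_lim => //; exact: Rhausdorff. Qed.

Lemma ae_derive_primitive (r rho : R -> R) :
  mu.-integrable setT (EFin \o r) ->
  (forall s t, s <= t -> rho t - rho s = \int[mu]_(x in `]s, t]) r x) ->
  {ae mu, forall x : R, is_derive x 1 rho (r x)}.
Proof.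
move=> ir rhoE.
pose I x := \int[mu]_(y in `]-oo, x]) r y.
have rI x : rho x = rho 0 - I 0 + I x.
  have [x0|/ltW x0] := leP 0 x.
    have := rhoE _ _ x0; rewrite (Rintegral_oc_split ir x0) -/(I x) -/(I 0) => ?; lra.
  have := rhoE _ _ x0; rewrite (Rintegral_oc_split ir x0) -/(I x) -/(I 0) => ?; lra.
have -> : rho = (fun x => rho 0 - I 0 + I x) by apply/funext.
have : {ae mu, forall x, derivable I x 1 /\ derive1 I x = r x}.
  apply: FTC1Ny => [y|]; first exact: integrableS ir.
  exact: open_integrable_locally openT ir.
apply: filterS => x [dI I'E].
rewrite -I'E derive1E -[X in is_derive _ _ _ X]add0r.
by apply: is_deriveD; exact: DeriveDef.
Qed.

Lemma le_Rintegral_oc (r m : R -> R) s t :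
  mu.-integrable setT (EFin \o r) -> mu.-integrable setT (EFin \o m) ->
  {ae mu, forall x, r x <= m x} ->
  \int[mu]_(x in `]s, t]) r x <= \int[mu]_(x in `]s, t]) m x.
Proof.
move=> ir im rm.
have irS : mu.-integrable `]s, t] (EFin \o r) by apply: integrableS ir.
have imS : mu.-integrable `]s, t] (EFin \o m) by apply: integrableS im.
rewrite -subr_ge0 -RintegralB//.
(* The inequality holds only almost everywhere; the absolute value is nonnegative everywhere and has
   the same integral. *)
have -> : \int[mu]_(x in `]s, t]) (m x - r x) =
          \int[mu]_(x in `]s, t]) (`|m x - r x|).
  have iB : mu.-integrable `]s, t] (EFin \o (fun x => m x - r x)).
    by rewrite (_ : EFin \o _ = (EFin \o m) \- (EFin \o r))%E//; exact: integrableB.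
  rewrite /Rintegral; congr fine; apply: ae_eq_integral => //.
  - exact: (measurable_int mu iB).
  - exact: (measurable_int mu (integrable_abse iB)).
  - by apply: filterS rm => x rmx _; rewrite ger0_norm// subr_ge0.
by apply: Rintegral_ge0 => x _.
Qed.

(** Enumerates the rationals; indices that encode no rational repeat the value 0. *)
Let q (n : nat) : R := ratr (odflt 0 (unpickle n : option rat)).

Let q_dense (s t : R) : s < t -> exists n, s < q n < t.
Proof.
move=> /rat_in_itvoo[p]; rewrite in_itv/= => sp; exists (pickle p).
by rewrite /q pickleK.
Qed.

(* The metric derivative is the supremum of the |rho_n'|, where rho_n is the
   distance to the n-th point of a dense sequence of the curve. *)
Lemma ae_metric_deriv (X : Type) (d : X -> X -> R) (b : R -> X) (m : R -> R) :
  is_metric d -> (forall x, 0 <= m x) -> mu.-integrable setT (EFin \o m) ->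
  (forall s t, s <= t -> d (b s) (b t) <= \int[mu]_(x in `]s, t]) m x) ->
  {ae mu, forall x, exists v, forall e, 0 < e -> exists2 dl, 0 < dl &
     forall h, h != 0 -> `|h| < dl -> `|d (b (x + h)) (b x) / `|h| - v| <= e}.
Proof.
move=> [d0 [deq [dsym dtri]]] m0 im bm.
pose rho n t := d (b t) (b (q n)).
have lip n s t : `|rho n t - rho n s| <= d (b s) (b t).
  rewrite /rho ler_norml; apply/andP; split.
    by have := dtri (b s) (b t) (b (q n)); lra.
  by have := dtri (b t) (b s) (b (q n)); rewrite (dsym (b t) (b s)); lra.
have /choice[r rP] : forall n, exists rn : R -> R,
    mu.-integrable setT (EFin \o rn) /\
    (forall s t, s <= t -> rho n t - rho n s = \int[mu]_(x in `]s, t]) rn x).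
  move=> n; apply: (primitive_of_le_integral m0 im) => s t st.
  exact: le_trans (lip _ _ _) (bm _ _ st).
have dr : {ae mu, forall x : R, forall n, is_derive x 1 (rho n) (r n x)}.
  by apply/ae_foralln => n; have [ir rE] := rP n; exact: ae_derive_primitive.
pose M x := \int[mu]_(y in `]-oo, x]) m y.
have dM : {ae mu, forall x : R, is_derive x 1 M (m x)}.
  by apply: ae_derive_primitive => // s t st; rewrite (Rintegral_oc_split im st).
have dMle x h : d (b (x + h)) (b x) <= `|M (x + h) - M x|.
  have [h0|h0] := leP 0 h.
    have xh : x <= x + h by rewrite lerDl.
    rewrite dsym; apply: le_trans (bm _ _ xh) _.
    by rewrite (Rintegral_oc_split im xh) ler_norm.
  have xh : x + h <= x by rewrite gerDl ltW.
  apply: le_trans (bm _ _ xh) _.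
  by rewrite (Rintegral_oc_split im xh) distrC ler_norm.
have rm : {ae mu, forall x, forall n, `|r n x| <= m x}.
  apply: filterS2 dr dM => x drx dMx n.
  apply/ler_addgt0Pr => e e0.
  have e2 : 0 < e / 2 by rewrite divr_gt0.
  have [d1 d10 H1] := (is_derive_epsP _ _ _).1 (drx n) _ e2.
  have [d2 d20 H2] := (is_derive_epsP _ _ _).1 dMx _ e2.
  pose h := Num.min d1 d2 / 2.
  have dm0 : 0 < Num.min d1 d2 by rewrite lt_min d10.
  have h0 : 0 < h by rewrite divr_gt0.
  have : `|h| < Num.min d1 d2 by rewrite gtr0_norm// /h; lra.
  rewrite lt_min => /andP[/H1 {}H1 /H2 {}H2]; move: H2 H1.
  have := lip n x (x + h); rewrite dsym => /le_trans/(_ (dMle x h)).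
  rewrite (gtr0_norm h0) => H3 H2 H1.
  have tri (a c : R) : `|a| <= `|c| + `|c - a|.
    by rewrite -[a in leLHS](subKr c); exact: ler_normB.
  rewrite -(ler_pM2r h0) -[in leLHS](gtr0_norm h0) -normrM mulrDl.
  have T1 := tri (r n x * h) (rho n (x + h) - rho n x).
  have T2 := tri (M (x + h) - M x) (m x * h).
  rewrite distrC in H2.
  have mh : `|m x * h| = m x * h by rewrite ger0_norm// mulr_ge0// ltW.
  have e2h : e * h = e / 2 * h + e / 2 * h by rewrite -mulrDl -splitr.
  rewrite mh in T2; lra.
(* Truncation by [m] bounds the family at every [x], so its supremum is a real function everywhere,
   measurable and dominated by [m]. *)
pose W n x := Num.min `|r n x| (m x).
have Wub x : has_ubound (range (W ^~ x)).
  by exists (m x) => _ [n _ <-]; rewrite /W ge_min lexx orbT.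
pose V x := sups (W ^~ x) 0%N.
have VE x : V x = sup (range (W ^~ x)).
  rewrite /V /sups/= /sdrop; congr sup; apply/seteqP; split => y [n _ <-]; by exists n.
have WV n x : W n x <= V x.
  by rewrite VE; apply: ub_le_sup; [exact: Wub|exists n].
have W0 n x : 0 <= W n x by rewrite le_min normr_ge0 m0.
have V0 x : 0 <= V x by exact: le_trans (W0 0%N x) (WV _ _).
have Vm x : V x <= m x.
  rewrite VE; apply: ge_sup; first by exists (W 0%N x), 0%N.
  by move=> _ [n _ <-]; rewrite /W ge_min lexx orbT.
have mfm : measurable_fun setT m by apply/measurable_EFinP; exact: (measurable_int mu).
have iV : mu.-integrable setT (EFin \o V).
  apply: (le_integrable measurableT _ _ im).
    apply/measurable_EFinP; apply: measurable_fun_sups => [t _|n]; first exact: Wub.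
    apply: measurable_minr => //; apply: measurableT_comp => //.
    by apply/measurable_EFinP; apply: (measurable_int mu); have [] := rP n.
  by move=> x _; rewrite /= lee_fin !ger0_norm.
have bV s t : s <= t -> d (b s) (b t) <= \int[mu]_(x in `]s, t]) V x.
  move=> st; apply/ler_addgt0Pr => e e0.
  have e2 : 0 < e / 2 by rewrite divr_gt0.
  have [dl dl0 H] := small_Rintegral_oc s m0 im e2.
  (* With [q n] just after [s] the value [rho n s] is small, so [rho n t - rho n s] falls short of
     [d (b s) (b t)] by less than [e]. *)
  have [n /andP[sq qd]] : exists n, s < q n < s + dl by apply: q_dense; rewrite ltrDl.
  have sqn : d (b s) (b (q n)) < e / 2.
    exact: le_lt_trans (bm _ _ (ltW sq)) (H _ _ (ltW sq) qd).
  have rV : rho n t - rho n s <= \int[mu]_(x in `]s, t]) V x.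
    have [ir ->//] := rP n; apply: le_Rintegral_oc => //.
    apply: filterS rm => x rmx; apply: le_trans (WV n x).
    by rewrite /W min_l ?rmx// ler_norm.
  have := dtri (b s) (b (q n)) (b t); rewrite (dsym (b (q n))) /=.
  by move: rV; rewrite /rho; lra.
pose IV x := \int[mu]_(y in `]-oo, x]) V y.
have dV : {ae mu, forall x : R, is_derive x 1 IV (V x)}.
  by apply: ae_derive_primitive => // s t st; rewrite (Rintegral_oc_split iV st).
have dVle x h : d (b (x + h)) (b x) <= `|IV (x + h) - IV x|.
  have [h0|h0] := leP 0 h.
    have xh : x <= x + h by rewrite lerDl.
    rewrite dsym; apply: le_trans (bV _ _ xh) _.
    by rewrite (Rintegral_oc_split iV xh) ler_norm.
  have xh : x + h <= x by rewrite gerDl ltW.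
  apply: le_trans (bV _ _ xh) _.
  by rewrite (Rintegral_oc_split iV xh) distrC ler_norm.
(* The quotient is bounded above through the derivative of the integral of [V], and below through a
   single [rho n] whose [|r n x|] is within [e / 2] of [V x]. *)
apply: filterS3 dr rm dV => x drx rmx dVx; exists (V x) => e e0.
have e2 : 0 < e / 2 by rewrite divr_gt0.
have [n Wn] : exists n, V x - e / 2 < `|r n x|.
  have : V x - e / 2 < sup (range (W ^~ x)) by rewrite -VE; lra.
  move=> /sup_gt[|_ [n _ <-] H]; first by exists (W 0%N x), 0%N.
  by exists n; apply: lt_le_trans H _; rewrite /W ge_min lexx.
have [d1 d10 H1] := (is_derive_epsP _ _ _).1 (drx n) _ e2.
have [d2 d20 H2] := (is_derive_epsP _ _ _).1 dVx _ e2.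
exists (Num.min d1 d2); first by rewrite lt_min d10.
move=> h h0; rewrite lt_min => /andP[hd1 hd2].
have {H1} := H1 h hd1; have {H2} := H2 h hd2.
have hp : 0 < `|h| by rewrite normr_gt0.
have := dVle x h; have := lip n x (x + h); rewrite (dsym (b x)).
move=> H3 H4 H2 H1.
have hp0 : `|h| != 0 by rewrite gt_eqF.
rewrite -(ler_pM2r hp) -[X in _ * X <= _]normr_id -normrM mulrBl divfK//.
have tri (a c : R) : `|a| <= `|c| + `|c - a|.
  by rewrite -[a in leLHS](subKr c); exact: ler_normB.
have T1 := tri (r n x * h) (rho n (x + h) - rho n x).
have T2 := tri (IV (x + h) - IV x) (V x * h).
rewrite distrC in H2.
have Vh : `|V x * h| = V x * `|h| by rewrite normrM ger0_norm.
have e2h : e * `|h| = e / 2 * `|h| + e / 2 * `|h| by rewrite -mulrDl -splitr.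
have : (V x - e / 2) * `|h| <= `|r n x * h| by rewrite normrM ler_pM2r// ltW.
have : 0 <= e / 2 * `|h| by rewrite mulr_ge0// ltW.
rewrite mulrBl => P1 P2.
rewrite Vh in T2; rewrite ler_norml; apply/andP; split; lra.
Qed.

End MetricDerivative.

(** * Real functions *)

Section PointwiseDerivatives.
Variables (R : realType) (x : R).
Implicit Types (f g : R -> R).

Lemma is_derive_mul f g df dg : is_derive x 1 f df -> is_derive x 1 g dg ->
  is_derive x 1 (fun t => f t * g t) (df * g x + f x * dg).
Proof.
move=> hf hg; have H : is_derive x 1 (f * g) (f x *: dg + g x *: df) by exact: is_deriveM.
by apply: (is_derive_eq H); rewrite /GRing.scale/=; ring.
Qed.

Lemma is_derive_sub f g df dg : is_derive x 1 f df -> is_derive x 1 g dg ->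
  is_derive x 1 (fun t => f t - g t) (df - dg).
Proof. by move=> hf hg; exact: is_deriveB. Qed.

Lemma is_derive_add f g df dg : is_derive x 1 f df -> is_derive x 1 g dg ->
  is_derive x 1 (fun t => f t + g t) (df + dg).
Proof. by move=> hf hg; exact: is_deriveD. Qed.

Lemma is_derive_scale k f df : is_derive x 1 f df ->
  is_derive x 1 (fun t => k * f t) (k * df).
Proof. by move=> hf; exact: is_deriveZ. Qed.

Lemma is_derive_opp f df : is_derive x 1 f df ->
  is_derive x 1 (fun t => - f t) (- df).
Proof. by move=> hf; exact: is_deriveN. Qed.

Lemma is_derive_inv f df : f x != 0 -> is_derive x 1 f df ->
  is_derive x 1 (fun t => (f t)^-1) (- (f x) ^- 2 * df).
Proof. by move=> fx hf; exact: is_deriveV. Qed.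

Lemma is_derive_subr f df c : is_derive x 1 f df -> is_derive x 1 (fun t => f t - c) df.
Proof. by move=> hf; rewrite -[X in is_derive _ _ _ X]subr0; exact: is_deriveB. Qed.

Lemma is_derive_rsub f df c : is_derive x 1 f df -> is_derive x 1 (fun t => c - f t) (- df).
Proof. by move=> hf; rewrite -[X in is_derive _ _ _ X]sub0r; exact: is_deriveB. Qed.

Lemma is_derive_comp f g df dg : is_derive x 1 f df -> is_derive (f x) 1 g dg ->
  is_derive x 1 (fun t => g (f t)) (dg * df).
Proof. by move=> hf hg; exact: is_derive1_comp. Qed.

End PointwiseDerivatives.

Section RealTools.
Variables (R : realType).
Notation mu := (@lebesgue_measure R).

Lemma mvt_closed (f df : R -> R) (a b : R) : a < b ->
  (forall x, a <= x <= b -> is_derive x 1 f (df x)) ->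
  exists2 c, a < c < b & f b - f a = df c * (b - a).
Proof.
move=> ab H; have [||c] := @MVT R f df a b ab.
- by move=> x; rewrite in_itv/= => /andP[ax xb]; apply: H; rewrite !ltW.
- apply: derivable_within_continuous => x; rewrite in_itv/= => /H.
  exact: @ex_derive.
by rewrite in_itv/=; exists c.
Qed.

Lemma is_derive_continuous (f : R -> R) (x l : R) :
  is_derive x 1 f l -> {for x, continuous f}.
Proof. by move=> [df _]; apply/differentiable_continuous/derivable1_diffP. Qed.

Lemma continuous_sqr (g : R -> R) (x : R) :
  {for x, continuous g} -> {for x, continuous (fun u => g u ^+ 2)}.
Proof.
move=> cg; apply: (@continuous_comp _ _ _ g (fun x => x ^+ 2)) => //.
exact: exprn_continuous.
Qed.

Lemma continuous_sqrt (g : R -> R) (x : R) :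
  {for x, continuous g} -> {for x, continuous (fun u => Num.sqrt (g u))}.
Proof.
by move=> cg; apply: (@continuous_comp _ _ _ g (@Num.sqrt R)) => //; exact: sqrt_continuous.
Qed.

(** Where the difference quotient diverges, [lim] takes the default value 0; a positive value
    therefore implies derivability. *)
Lemma derive1_gt0_is_derive (f : R -> R) (x : R) :
  0 < derive1 f x -> is_derive x 1 f (derive1 f x).
Proof.
move=> H; have df : derivable f x 1.
  apply: contrapT => ndf; move: H; rewrite derive1E /derive dvgP// => H.
  by rewrite ltxx in H.
by rewrite derive1E; exact: DeriveDef.
Qed.

Lemma ae_itv_exists (P : R -> Prop) (a b : R) : a < b ->
  {ae mu, forall t, a <= t <= b -> P t} -> exists2 t, a < t < b & P t.
Proof.
move=> ab [N [mN N0 sN]]; apply: contrapT => H.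
have sub : `]a, b[%classic `<=` N.
  move=> t; rewrite /= in_itv/= => tab; apply: sN => /= Pt; apply: H; exists t => //.
  by apply: Pt; case/andP: tab => /ltW -> /ltW ->.
have : (mu `]a, b[%classic <= mu N)%E by apply: le_measure; rewrite ?inE//; exact: measurable_itv.
rewrite [X in (_ <= X)%E](_ : _ = 0%E)//.
by rewrite lebesgue_measure_itv/= lte_fin ab -EFinD lee_fin leNgt subr_gt0 ab.
Qed.

Import HBNNSimple.

(** The length integrand contains [metric_deriv], whose measurability is not established. The
    integral of a nonnegative function is a supremum over simple functions below it, and each of
    these is measurable and can be compared with [g]. *)
Lemma ae_le_integral_nonmeasurable (f g : R -> R) (D : set R) : measurable D ->
  (forall x, 0 <= f x) -> (forall x, 0 <= g x) -> measurable_fun D (EFin \o g) ->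
  {ae mu, forall x, D x -> f x <= g x} ->
  (\int[mu]_(x in D) (f x)%:E <= \int[mu]_(x in D) (g x)%:E)%E.
Proof.
move=> mD f0 g0 mg fg.
rewrite [leLHS]ge0_integralE; last by move=> x _; rewrite lee_fin.
apply: ge_ereal_sup => _ [h /= hf <-].
rewrite -integralT_nnsfun.
have hD x : ~ D x -> h x = 0.
  move=> nDx; have := hf x; rewrite patchE memNset// lee_fin => h0.
  by apply/eqP; rewrite eq_le h0/=.
rewrite (_ : \int[mu]_x (h x)%:E = \int[mu]_(x in D) (h x)%:E)%E; last first.
  rewrite [RHS]integral_mkcond; apply: eq_integral => x _; rewrite patchE.
  by case: ifPn => // /negP; rewrite inE => /hD ->.
apply: ae_ge0_le_integral => //.
- by move=> x _; rewrite lee_fin.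
- by apply/measurable_EFinP; exact: measurable_funTS.
- by move=> x _; rewrite lee_fin.
apply: filterS fg => x fgx Dx; rewrite lee_fin (le_trans _ (fgx Dx))//.
by have := hf x; rewrite patchE mem_set// lee_fin.
Qed.

(** Precomposition with [clamp a b] extends a function on [[a, b]] to the whole line, constant on
    either side. *)
Definition clamp (a b t : R) := Num.max a (Num.min b t).

Lemma clamp_id a b t : a <= t <= b -> clamp a b t = t.
Proof. by move=> /andP[at_ tb]; rewrite /clamp min_r// max_r. Qed.

Lemma clamp_itv a b t : a <= b -> a <= clamp a b t <= b.
Proof. by move=> ab; rewrite /clamp le_max lexx/= ge_max ab ge_min lexx. Qed.

Lemma clamp_le a b s t : s <= t -> clamp a b s <= clamp a b t.
Proof.
move=> st; rewrite /clamp ge_max le_max lexx/= le_max; apply/orP; right.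
by rewrite le_min !ge_min lexx/= st orbT.
Qed.

Lemma clamp_oc a b s t x : clamp a b s < x <= clamp a b t -> s < x <= t.
Proof.
rewrite /clamp gt_max gt_min le_max le_min => /andP[/andP[ax bsx] xat].
apply/andP; split.
  by case/orP: bsx => // bx; case/orP: xat => [|/andP[]]; lra.
by case/orP: xat => [|/andP[]//]; lra.
Qed.

(** Transfers the absolute continuity of a curve on [[a, b]] to its clamped extension, with a
    density that is nonnegative and vanishes outside the interval. *)
Lemma clamp_bound (a b : R) (m : R -> R) (D : R -> R -> R) :
  a < b -> mu.-integrable `[a, b] (EFin \o m) ->
  (forall s t, a <= s -> s <= t -> t <= b ->
     ((D s t)%:E <= \int[mu]_(u in `[s, t]) (m u)%:E)%E) ->
  let m' := fun x => `|(m \_ `[a, b]) x| in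
  mu.-integrable setT (EFin \o m') /\
  forall s t, s <= t -> D (clamp a b s) (clamp a b t) <= \int[mu]_(x in `]s, t]) m' x.
Proof.
move=> ab im H m'.
have im' : mu.-integrable setT (EFin \o m').
  rewrite (_ : EFin \o m' = abse \o ((EFin \o m) \_ `[a, b])); last first.
    by apply/funext => x; rewrite /m' /= !patchE; case: ifPn.
  by apply: integrable_abse; rewrite -integrable_mkcond.
split=> // s t st.
set s' := clamp a b s; set t' := clamp a b t.
have s't' : s' <= t' by exact: clamp_le.
have /andP[as' s'b] : a <= s' <= b by apply: clamp_itv; exact: ltW.
have /andP[at' t'b] : a <= t' <= b by apply: clamp_itv; exact: ltW.
have := H _ _ as' s't' t'b.
have ms : mu.-integrable `[s', t'] (EFin \o m).
  by apply: integrableS im => //; apply: subset_itv; rewrite bnd_simp.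
have ms' A : measurable A -> mu.-integrable A (EFin \o m') by move=> mA; exact: integrableS im'.
have -> : (\int[mu]_(u in `[s', t']) (m u)%:E = (\int[mu]_(u in `[s', t']) m u)%:E)%E.
  by rewrite /Rintegral fineK//; apply: integrable_fin_num.
rewrite lee_fin => /le_trans; apply.
apply: (@le_trans _ _ (\int[mu]_(u in `[s', t']) m' u)).
  apply: le_Rintegral => //; first exact: ms'.
  move=> x; rewrite /= in_itv/= => /andP[s'x xt'].
  rewrite /m' patchE mem_set ?ler_norm//= in_itv/= (le_trans as' s'x)/=.
  exact: le_trans xt' t'b.
rewrite -Rintegral_itv_obnd_cbnd; last exact: ms'.
rewrite /Rintegral fine_le//; [exact: integrable_fin_num (ms' _ _)..|].
apply: ge0_subset_integral => //.
- exact: (measurable_int mu (ms' _ _)).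
- by move=> x _; rewrite lee_fin normr_ge0.
- by move=> x; rewrite /= !in_itv/= => /clamp_oc.
Qed.
(** [is_derive] is two-sided even at [p] and [q]; so [g] is extended by its end values and
    integrated from [p - 1]. *)
Lemma antiderivative (g : R -> R) (p q : R) : p <= q ->
  (forall u, p <= u <= q -> {for u, continuous g}) ->
  exists G : R -> R, forall u, p <= u <= q -> is_derive u 1 G (g u).
Proof.
move=> pq cg; pose h := g \o clamp p q.
have clamp_cont : continuous (clamp p q).
  move=> x; apply: continuous_max; first exact: cvg_cst.
  by apply: continuous_min; [exact: cvg_cst|exact: cvg_id].
have ch : continuous h.
  move=> x; apply: continuous_comp; first exact: clamp_cont.
  by apply: cg; exact: clamp_itv.
exists (fun x => \int[mu]_(t in `[p - 1, x]) h t) => u pu.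
have ih : mu.-integrable `[p - 1, u + 1] (EFin \o h).
  apply: continuous_compact_integrable; first exact: segment_compact.
  exact: continuous_subspaceT.
have uu : u < u + 1 by rewrite ltrDl.
have pu1 : p - 1 < u by lra.
have [dG GE] := continuous_FTC1_closed uu ih pu1 (ch u).
have -> : g u = h u by rewrite /h /= clamp_id.
by rewrite -GE derive1E; exact: DeriveDef.
Qed.

Lemma derive_le_incr (f df g dg : R -> R) (a b : R) : a <= b ->
  (forall x, a <= x <= b -> is_derive x 1 f (df x)) ->
  (forall x, a <= x <= b -> is_derive x 1 g (dg x)) ->
  (forall x, a <= x <= b -> df x <= dg x) ->
  f b - f a <= g b - g a.
Proof.
rewrite le_eqVlt => /orP[/eqP->|ab] Hf Hg fg; first by rewrite !subrr.
have [x xab|x /andP[ax xb] E] := @mvt_closed (g \- f) (fun x => dg x - df x) a b ab.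
  by apply: is_deriveB; [exact: Hg|exact: Hf].
have : 0 <= (dg x - df x) * (b - a).
  by rewrite mulr_ge0 ?subr_ge0 ?(ltW ab)// fg// !ltW.
by rewrite -E /=; lra.
Qed.

Lemma derive_lt_incr (f df g dg : R -> R) (a b : R) : a < b ->
  (forall x, a <= x <= b -> is_derive x 1 f (df x)) ->
  (forall x, a <= x <= b -> is_derive x 1 g (dg x)) ->
  (forall x, a < x < b -> df x < dg x) ->
  f b - f a < g b - g a.
Proof.
move=> ab Hf Hg fg.
have [x xab|x xab E] := @mvt_closed (g \- f) (fun x => dg x - df x) a b ab.
  by apply: is_deriveB; [exact: Hg|exact: Hf].
have : 0 < (dg x - df x) * (b - a).
  by rewrite mulr_gt0 ?subr_gt0 ?ab// fg.
by rewrite -E /=; lra.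
Qed.

Lemma clamp_lipschitz (a b x y : R) : `|clamp a b x - clamp a b y| <= `|x - y|.
Proof.
wlog xy : x y / x <= y.
  by move=> K; have [xy|/ltW yx] := leP x y; [exact: K|rewrite distrC (distrC x); exact: K].
have := clamp_le a b xy; rewrite -subr_ge0 distrC => /ger0_norm ->.
rewrite distrC ger0_norm ?subr_ge0// /clamp.
case: (leP b x) => ?; case: (leP b y) => ?; last case: (leP a x) => ?; try case: (leP a y) => ?;
  try case: (leP a b) => ?; try case: (leP a x) => ?; lra.
Qed.

(** Continuity is relative to [[a, b]], as [tau] is known to be continuous only on a
    neighborhood. *)
Lemma ivt_eps (F : R -> R) (a b : R) : a <= b ->
  (forall s, a <= s <= b -> forall e, 0 < e -> exists2 dl, 0 < dl &
     forall t, a <= t <= b -> `|s - t| < dl -> `|F s - F t| < e) ->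
  F a <= 0 -> 0 <= F b -> exists2 s, a <= s <= b & F s = 0.
Proof.
move=> ab cF Fa Fb.
have cFc : continuous (F \o clamp a b).
  move=> x; apply/cvgrPdist_lt => e e0.
  have [dl dl0 H] := cF _ (clamp_itv x ab) e e0.
  exists dl => // y xy /=; apply: H; first exact: clamp_itv.
  exact: le_lt_trans (clamp_lipschitz _ _ _ _) xy.
have aE : clamp a b a = a by apply: clamp_id; rewrite lexx.
have bE : clamp a b b = b by apply: clamp_id; rewrite lexx ab.
have [||s _ sE] := @IVT R (F \o clamp a b) a b 0 ab.
- exact: continuous_subspaceT.
- by rewrite /= aE bE ge_min Fa le_max Fb orbT.
by exists (clamp a b s); [exact: clamp_itv|].
Qed.

Lemma pos_lower_bound (s : seq R) : all (fun x => 0 < x) s ->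
  exists2 e, 0 < e & all (fun x => e <= x) s.
Proof.
elim: s => [_|x s IH /= /andP[x0 /IH[e e0 es]]]; first by exists 1.
exists (Num.min x e); first by rewrite lt_min x0.
rewrite ge_min lexx/=; apply: sub_all es => y ey.
by rewrite ge_min ey orbT.
Qed.

End RealTools.

(** * Lengths of causal curves *)

Section FutureDirected.
Variables (R : realType) (X : Type) (d : X -> X -> R) (I : set R) (f : R -> R).

(** Strict monotonicity in either direction is part of the definition; one interior point of
    positive derivative excludes the decreasing case. *)
Lemma fd_curve_increasing tl y y' (g : curveT R X) : fd_curve d I f tl y y' g ->
  forall s t, cs0 g <= s -> s < t -> t <= cs1 g -> calpha g s < calpha g t.
Proof.
move=> [g01 [_ [_ [_ [_ [[//|dec] [_ pos]]]]]]].
have [t /andP[g0t tg1] a0] := ae_itv_exists g01 pos.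
have a2 : 0 < derive1 (calpha g) t / 2 by rewrite divr_gt0.
have /is_derive_epsP/(_ _ a2)[dl dl0 H] := derive1_gt0_is_derive a0.
have dm0 : 0 < Num.min dl (cs1 g - t) by rewrite lt_min dl0 subr_gt0.
pose h := Num.min dl (cs1 g - t) / 2.
have h0 : 0 < h by rewrite divr_gt0.
have : h < Num.min dl (cs1 g - t) by rewrite /h; lra.
rewrite lt_min => /andP[hdl hg].
have := H h; rewrite gtr0_norm// => /(_ hdl); rewrite ler_norml => /andP[H1 _].
have := dec t (t + h) (ltW g0t); rewrite ltrDl => /(_ h0) D.
have {}D : calpha g (t + h) < calpha g t by apply: D; lra.
have : 0 < derive1 (calpha g) t * h by rewrite mulr_gt0.
lra.
Qed.

Lemma fd_curve_lt tl y y' (g : curveT R X) : fd_curve d I f tl y y' g -> y.1 < y'.1.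
Proof.
move=> fd; have inc := fd_curve_increasing fd.
case: fd => g01 [g0 [g1 _]].
by have := inc _ _ (lexx _) g01 (lexx _); rewrite /calpha g0 g1.
Qed.

End FutureDirected.

(** With [k = c / F] and [w = F v] one has [p^2 - k^2 = 1], so [(p a - k w)^2 - (a^2 - w^2) = (k a -
    p w)^2]. *)
Lemma sqrt_calibration (R : realType) (p F v c a : R) : 0 < F -> 0 <= c -> 0 < a -> 0 <= v ->
  - a ^+ 2 + F ^+ 2 * v ^+ 2 <= 0 -> p = Num.sqrt (1 + (c / F) ^+ 2) ->
  Num.sqrt (a ^+ 2 - F ^+ 2 * v ^+ 2) <= p * a - c * v.
Proof.
move=> F0 c0 a0 v0 H pE.
have p0 : 0 <= p by rewrite pE sqrtr_ge0.
have p2 : p ^+ 2 = 1 + (c / F) ^+ 2 by rewrite pE sqr_sqrtr// addr_ge0// sqr_ge0.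
have [k kE] : exists k, k = c / F by exists (c / F).
have cE : c = k * F by rewrite kE divfK// gt_eqF.
have k0 : 0 <= k by rewrite kE divr_ge0// ltW.
rewrite -kE in p2; rewrite cE -mulrA.
have [w wE] : exists w, w = F * v by exists (F * v).
have w0 : 0 <= w by rewrite wE mulr_ge0// ltW.
rewrite -exprMn -wE in H *.
have wa : w <= a by rewrite -(@ler_pXn2r _ 2)// ?nnegrE ?(ltW a0)//; lra.
have kp : k <= p by rewrite -(@ler_pXn2r _ 2)// ?nnegrE//; lra.
have kw : 0 <= p * a - k * w by rewrite subr_ge0 ler_pM.
rewrite -(ger0_norm kw) -sqrtr_sqr ler_sqrt ?sqr_ge0//.
have : 0 <= (k * a - p * w) ^+ 2 by exact: sqr_ge0.
have E : (p * a - k * w) ^+ 2 - (a ^+ 2 - w ^+ 2) = (k * a - p * w) ^+ 2 +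
  (p ^+ 2 - (1 + k ^+ 2)) * (a ^+ 2 - w ^+ 2) by ring.
by rewrite p2 subrr mul0r addr0 in E; rewrite -E subr_ge0.
Qed.

(* [t |-> G (alpha t) - c * d (beta 0) (beta t)] is a calibration: by the reverse
   Cauchy-Schwarz inequality its derivative dominates the length element. *)
Lemma curve_length_le (R : realType) (X : Type) (d : X -> X -> R) (I : set R) (f : R -> R)
    (c b : R) (G : R -> R) y y' (g : curveT R X) :
  is_metric d ->
  0 <= c -> 0 < b -> fd_curve d I f false y y' g ->
  (forall t, y.1 <= t <= y'.1 -> b <= f t) ->
  (forall t, y.1 <= t <= y'.1 -> is_derive t 1 G (Num.sqrt (1 + (c / f t) ^+ 2))) ->
  (curve_length d f g <= (G y'.1 - G y.1 - c * d y.2 y'.2)%:E)%E.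
Proof.
move=> dm c0 b0 fd fb dG; pose mu := @lebesgue_measure R.
have inc := fd_curve_increasing fd; have yy' := fd_curve_lt fd.
have [d0 [deq [dsym dtri]]] := dm.
case: fd => g01 [g0 [g1 [_ [[m [im ac]] [_ [cau pos]]]]]].
set s0 := cs0 g in g01 g0 im ac cau pos inc *; set s1 := cs1 g in g01 g1 im ac cau pos inc *.
pose m' := fun x => `|(m \_ `[s0, s1]) x|.
have [im' bnd] := clamp_bound g01 im ac.
rewrite -/m' in im' bnd.
pose K t := clamp s0 s1 t.
have Kitv t : s0 <= K t <= s1 by apply: clamp_itv; exact: ltW.
have dB s t : s <= t -> d (cbeta g (K s)) (cbeta g (K t)) <= \int[mu]_(x in `]s, t]) m' x.
  by move=> st; apply: le_trans (bnd _ _ st); rewrite /Dist lerDr.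
have dA s t : s <= t -> `|calpha g (K s) - calpha g (K t)| <= \int[mu]_(x in `]s, t]) m' x.
  by move=> st; apply: le_trans (bnd _ _ st); rewrite /Dist lerDl.
have incle s t : s0 <= s -> s <= t -> t <= s1 -> calpha g s <= calpha g t.
  by move=> ?; rewrite le_eqVlt => /orP[/eqP->//|? ?]; apply/ltW/inc.
have aitv t : s0 <= t <= s1 -> y.1 <= calpha g t <= y'.1.
  move=> /andP[s0t ts1]; have := incle _ _ (lexx _) s0t ts1.
  have := incle _ _ s0t ts1 (lexx _); rewrite /calpha g0 g1 => -> ->//.
(* A Lipschitz constant of [G], from [sqrt (1 + k^2) <= 1 + k] for [k >= 0]. *)
pose B := 1 + c / b.
have B0 : 0 <= B by rewrite /B addr_ge0// divr_ge0// ltW.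
pose p t := Num.sqrt (1 + (c / f t) ^+ 2).
have pB t : y.1 <= t <= y'.1 -> 0 <= p t <= B.
  move=> /fb bf; have f0 := lt_le_trans b0 bf; rewrite sqrtr_ge0/= -(ger0_norm B0) -sqrtr_sqr.
  rewrite ler_sqrt ?sqr_ge0//.
  have q0 : 0 <= c / f t by rewrite divr_ge0// ltW.
  have qb : c / f t <= c / b by rewrite ler_wpM2l// lef_pV2 ?posrE.
  by rewrite /B; nra.
have Glip s t : y.1 <= s -> s <= t -> t <= y'.1 -> 0 <= G t - G s <= B * (t - s).
  move=> ys; rewrite le_eqVlt => /orP[/eqP->|st ty']; first by rewrite !subrr mulr0 lexx.
  have [|x /andP[sx xt] ->] := @mvt_closed R G p s t st.
    by move=> x /andP[sx xt]; apply: dG; rewrite (le_trans ys sx) (le_trans xt ty').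
  have /andP[px0 pxB] : 0 <= p x <= B by apply: pB; lra.
  by rewrite mulr_ge0 ?subr_ge0 ?(ltW st)//= ler_wpM2r// subr_ge0 ltW.
pose Phi t := G (calpha g (K t)) - c * d y.2 (cbeta g (K t)).
pose n x := (B + c) * m' x.
have m'0 x : 0 <= m' x by exact: normr_ge0.
have n0 x : 0 <= n x.
  by apply: mulr_ge0 => //; apply: addr_ge0.
have in_ : mu.-integrable setT (EFin \o n).
  rewrite (_ : EFin \o n = (fun x => (B + c)%:E * (EFin \o m') x)%E)//.
  exact: integrableZl.
have Philip s t : s <= t -> `|Phi t - Phi s| <= \int[mu]_(x in `]s, t]) n x.
  move=> st; rewrite RintegralZl//; last by apply: integrableS im'.
  have Kst : K s <= K t by exact: clamp_le.
  have /andP[Ks0 Ks1] := Kitv s; have /andP[Kt0 Kt1] := Kitv t.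
  have /andP[as0 as1] := aitv _ (Kitv s); have /andP[at0 at1] := aitv _ (Kitv t).
  have aKst := incle _ _ Ks0 Kst Kt1.
  have /andP[Gl Gr] := Glip _ _ as0 aKst at1.
  have := dA _ _ st; rewrite distrC ger0_norm ?subr_ge0// => /(ler_wpM2l B0) Am.
  have /(ler_wpM2l c0) Bm := dB _ _ st.
  have /(ler_wpM2l c0) T1 := dtri y.2 (cbeta g (K s)) (cbeta g (K t)).
  have /(ler_wpM2l c0) T2 := dtri y.2 (cbeta g (K t)) (cbeta g (K s)).
  rewrite (dsym (cbeta g (K t)) (cbeta g (K s))) in T2.
  rewrite mulrDl; rewrite !mulrDr in T1 T2.
  by rewrite /Phi ler_norml; move: Gl Gr Am Bm T1 T2; clear => *; apply/andP; split; lra.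
have [phi [iphi phiE]] := primitive_of_le_integral n0 in_ Philip.
have dphi := ae_derive_primitive iphi phiE.
have mder := ae_metric_deriv dm m'0 im' dB.
have Phi01 : \int[mu]_(x in `]s0, s1]) phi x = G y'.1 - G y.1 - c * d y.2 y'.2.
  rewrite -(phiE _ _ (ltW g01)) /Phi /K !clamp_id ?lexx ?(ltW g01)//.
  rewrite /calpha /cbeta g0 g1.
  have -> : d y.2 y.2 = 0 by exact/deq.
  ring.
rewrite /curve_length -/s0 -/s1 -[Defs.mu (R:=R)]/mu.
have ioc A : measurable A -> mu.-integrable A (EFin \o phi) by move=> mA; exact: integrableS iphi.
(* At the end points the derivatives of the curve may differ from those of its clamped extension;
   these points are discarded. *)
have aeoo : {ae mu, forall x, x != s0 /\ x != s1}.
  have nS a : mu.-negligible [set a].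
    by exists [set a]; split => //; exact: lebesgue_measure_set1.
  apply: negligibleS (negligibleU (nS s0) (nS s1)) => x /= /not_andP[].
    by move=> /negP; rewrite negbK => /eqP ->; left.
  by move=> /negP; rewrite negbK => /eqP ->; right.
pose q t := Num.sqrt ((derive1 (calpha g) t) ^+ 2 -
  (f (calpha g t)) ^+ 2 * (metric_deriv d (cbeta g) t) ^+ 2).
have key : {ae mu, forall x, `[s0, s1]%classic x -> 0 <= phi x /\ q x <= phi x}.
  apply: filterS (filterI (filterI dphi mder) (filterI (filterI cau pos) aeoo)).
  move=> x [[dphix [v vP]] [[caux posx] [xs0 xs1]]] xs.
  have {}xs : s0 <= x <= s1 by rewrite /= in_itv/= in xs.
  move: (caux xs) (posx xs) => {}caux {}posx.
  have [x0 x1] : s0 < x /\ x < s1.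
    by move: xs; rewrite !le_eqVlt [s0 == x]eq_sym (negbTE xs0) (negbTE xs1) => /andP[].
  have vE : metric_deriv d (cbeta g) x = v.
    apply: metric_deriv_eq => e e0; have [dl dl0 H] := vP e e0.
    exists (Num.min dl (Num.min (x - s0) (s1 - x))).
      by rewrite !lt_min dl0 !subr_gt0 x0.
    move=> h h0; rewrite !lt_min => /and3P[hdl hx0 hx1].
    have := H h h0 hdl; rewrite /K !clamp_id//.
    move: hx0 hx1; clear; rewrite !ltr_norml => /andP[? ?] /andP[? ?].
    by apply/andP; split; lra.
  have v0 : 0 <= v.
    apply/ler_addgt0Pr => e e0; have [dl dl0 H] := vP e e0.
    have h0 : 0 < dl / 2 by rewrite divr_gt0.
    have := H (dl / 2) (lt0r_neq0 h0); rewrite gtr0_norm// => H'.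
    have : dl / 2 < dl by move: dl0; clear; lra.
    move=> /H'; rewrite ler_norml => /andP[_].
    have : 0 <= d (cbeta g (K (x + dl / 2))) (cbeta g (K x)) / (dl / 2) by rewrite divr_ge0// ltW.
    by clear; lra.
  have ya := aitv x xs.
  have a0 := posx; set a := derive1 (calpha g) x in a0.
  have da : is_derive x 1 (calpha g) a by exact: derive1_gt0_is_derive.
  have dGa : is_derive x 1 (G \o calpha g) (p (calpha g x) * a).
    have := dG _ ya => dGx; exact: is_derive1_comp.
  (* By the triangle inequality the distance to [y.2] grows at speed at most [v]. Two errors [e' h]
     come from the derivatives of [G] along the curve and of [Phi], and one error [c e' h] from the
     metric derivative; hence the denominator [2 + c]. *)
  have low : p (calpha g x) * a - c * v <= phi x.
    apply/ler_addgt0Pr => e e0.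
    have c2 : 0 < 2 + c by move: c0; clear; lra.
    pose e' := e / (2 + c).
    have e'0 : 0 < e' by rewrite divr_gt0.
    have eE : e = 2 * e' + c * e' by rewrite -mulrDl /e' mulrC divfK// gt_eqF.
    have [d1 d10 H1] := (is_derive_epsP _ _ _).1 dGa _ e'0.
    have [d2 d20 H2] := (is_derive_epsP _ _ _).1 dphix _ e'0.
    have [d3 d30 H3] := vP _ e'0.
    have dm0 : 0 < Num.min (s1 - x) (Num.min d1 (Num.min d2 d3)).
      by rewrite !lt_min subr_gt0 x1 d10 d20.
    pose h := Num.min (s1 - x) (Num.min d1 (Num.min d2 d3)) / 2.
    have h0 : 0 < h by rewrite divr_gt0.
    have : h < Num.min (s1 - x) (Num.min d1 (Num.min d2 d3)).
      by rewrite /h; move: dm0; clear; lra.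
    rewrite !lt_min => /and4P[hx hd1 hd2 hd3].
    have := H1 h; have := H2 h; have := H3 h (lt0r_neq0 h0).
    rewrite (gtr0_norm h0) => /(_ hd3) {}H3 /(_ hd2) {}H2 /(_ hd1) {}H1.
    have Kx : K x = x by exact: clamp_id.
    have Kxh : K (x + h) = x + h.
      by apply: clamp_id; move: x0 h0 hx; clear => *; apply/andP; split; lra.
    move: H3 H2 H1; rewrite /Phi Kx Kxh /= !ler_norml => /andP[_ H3] /andP[_ H2] /andP[H1 _].
    have {}H3 : d (cbeta g (x + h)) (cbeta g x) <= (v + e') * h.
      by rewrite -ler_pdivrMr//; move: H3; clear; lra.
    have H4 := dtri y.2 (cbeta g x) (cbeta g (x + h)).
    rewrite (dsym (cbeta g x)) in H4.
    have {}H4 : c * d y.2 (cbeta g (x + h)) <=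
        c * d y.2 (cbeta g x) + c * ((v + e') * h).
      by rewrite -mulrDr ler_wpM2l//; move: H3 H4; clear; lra.
    by rewrite -(ler_pM2r h0) eE !mulrDl; move: H1 H2 H4; rewrite mulrDl mulrDr; clear; lra.
  have f0 : 0 < f (calpha g x) by exact: lt_le_trans b0 (fb _ ya).
  rewrite /q /= vE; move: caux; rewrite /causal_char vE => caux.
  have := sqrt_calibration f0 c0 a0 v0 caux (erefl _).
  rewrite -/(p _) => sc; split; last exact: le_trans sc low.
  by apply: le_trans low; apply: le_trans sc; exact: sqrtr_ge0.
have ic := ioc _ (measurable_itv `[s0, s1]).
(* [phi] is known to be nonnegative only almost everywhere on the interval, while the comparison of
   integrals asks for it everywhere. *)
apply: (@le_trans _ _ (\int[mu]_(x in `[s0, s1]) `|phi x|%:E)%E).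
  apply: (@ae_le_integral_nonmeasurable R q (fun x => `|phi x|) `[s0, s1]%classic) => //.
  - by move=> x; rewrite /q; exact: sqrtr_ge0.
  - exact: (measurable_int mu (integrable_abse ic)).
  - by apply: filterS key => x H /H[_ qx]; apply: le_trans qx (ler_norm _).
rewrite -Phi01 Rintegral_itv_obnd_cbnd; last exact: ioc.
rewrite /Rintegral fineK; last exact: integrable_fin_num.
rewrite (_ : (\int[mu]_(x in `[s0, s1]) `|phi x|%:E = \int[mu]_(x in `[s0, s1]) (phi x)%:E)%E)//.
apply: ae_eq_integral => //.
- exact: (measurable_int mu (integrable_abse ic)).
- exact: (measurable_int mu ic).
- by apply: filterS key => x H /H[p0 _]; rewrite ger0_norm.
Qed.

(** * Lifts of geodesics of the fiber with prescribed speed *)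

Section CurveConstruction.
Variables (R : realType) (X : Type) (d : X -> X -> R) (I : set R) (f : R -> R).
Notation mu := (@lebesgue_measure R).

Variables (s t l N : R) (c : R -> X) (B b H : R -> R).
Hypothesis st : s < t.
Hypothesis Ist : forall u, s <= u <= t -> I u.
Hypothesis c_geo : forall u v, 0 <= u <= l -> 0 <= v <= l -> d (c u) (c v) = `|u - v|.
Hypothesis dB : forall u, s <= u <= t -> is_derive u 1 B (b u).
Hypothesis Bs : B s = 0.
Hypothesis Bt : B t = l.
Hypothesis b_itv : forall u, s <= u <= t -> 0 <= b u <= N.
Hypothesis f_ge0 : forall u, s <= u <= t -> 0 <= f u.
Hypothesis fb1 : forall u, s <= u <= t -> f u * b u < 1.
Hypothesis cf_ : forall u, s <= u <= t -> {for u, continuous f}.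
Hypothesis cb : forall u, s <= u <= t -> {for u, continuous b}.
Hypothesis dH : forall u, s <= u <= t -> is_derive u 1 H (Num.sqrt (1 - (f u * b u) ^+ 2)).

(** Time is the parameter, so the first component has derivative 1 and the metric derivative of the
    second is the speed [b] at which [B] advances along the geodesic [c]. *)
Definition graph_curve : curveT R X := (s, t, fun u => (u, c (B u))).

Let Bincr u v : s <= u -> u <= v -> v <= t -> 0 <= B v - B u <= N * (v - u).
Proof.
move=> su; rewrite le_eqVlt => /orP[/eqP->|uv vt]; first by rewrite !subrr mulr0 lexx.
have [|w /andP[uw wv] ->] := @mvt_closed R B b u v uv.
  by move=> w /andP[uw wv]; apply: dB; rewrite (le_trans su uw) (le_trans wv vt).
have /andP[b0 bN] : 0 <= b w <= N by apply: b_itv; lra.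
have uv' : 0 <= v - u by rewrite subr_ge0 ltW.
by rewrite mulr_ge0//= ler_wpM2r.
Qed.

Let Bitv u : s <= u <= t -> 0 <= B u <= l.
Proof.
move=> /andP[su ut].
have /andP[h1 _] := Bincr (lexx _) su ut; have /andP[h2 _] := Bincr su ut (lexx _).
by rewrite Bs in h1; rewrite Bt in h2; apply/andP; split; lra.
Qed.

Let alphaE u : derive1 (calpha graph_curve) u = 1.
Proof. by rewrite derive1E; have := is_derive_id u (1 : R) => /@derive_val. Qed.

Let betaE u : s < u < t -> metric_deriv d (cbeta graph_curve) u = b u.
Proof.
move=> /andP[su ut]; apply: metric_deriv_eq => e e0.
have uitv : s <= u <= t by rewrite !ltW.
have [dl dl0 K] := (is_derive_epsP _ _ _).1 (dB uitv) e e0.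
exists (Num.min dl (Num.min (u - s) (t - u))).
  by rewrite !lt_min dl0 !subr_gt0 su.
move=> h h0; rewrite !lt_min => /and3P[/K {}K].
rewrite !ltr_norml => /andP[? ?] /andP[? ?].
rewrite /cbeta /= c_geo; [|by apply: Bitv; lra|exact: Bitv].
have hp : 0 < `|h| by rewrite normr_gt0.
have hp0 : `|h| != 0 by rewrite gt_eqF.
rewrite -(ler_pM2r hp) -[X in _ * X <= _]normr_id -normrM mulrBl divfK//.
apply: le_trans K.
have -> : b u * `|h| = `|b u * h| by rewrite normrM ger0_norm//; have /andP[] := b_itv uitv.
exact: ler_dist_dist.
Qed.

Let ae_interior : {ae mu, forall x, s <= x <= t -> s < x < t}.
Proof.
have nS a : mu.-negligible [set a].
  by exists [set a]; split => //; exact: lebesgue_measure_set1.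
apply: negligibleS (negligibleU (nS s) (nS t)) => x /= /not_implyP[xst].
move: xst; rewrite !le_eqVlt => /andP[/orP[/eqP <-|sx] /orP[/eqP ->|xt]] nx;
  [by left|by left|by right|].
by exfalso; apply: nx; rewrite sx.
Qed.

Lemma graph_curve_fd tl : fd_curve d I f tl (s, c 0) (t, c l) graph_curve.
Proof.
split; first exact: st.
split; first by rewrite /cf /cs0 /= Bs.
split; first by rewrite /cf /cs1 /= Bt.
split; first by move=> u; exact: Ist.
split.
  (* [1] accounts for the time component and [N] for the displacement along [c]. *)
  exists (fun=> 1 + N); split.
    apply: continuous_compact_integrable; first exact: segment_compact.
    by apply: continuous_subspaceT => x; exact: cvg_cst.
  move=> u v su uv vt; rewrite integral_cst/=; last exact: measurable_itv.
  rewrite [X in (_ <= _ * X)%E](_ : _ = (v - u)%:E).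
    rewrite -EFinM lee_fin /Dist /cf /= distrC ger0_norm ?subr_ge0//.
    have ut := le_trans uv vt; have sv := le_trans su uv.
    have /andP[B0 BN] := Bincr su uv vt.
    rewrite c_geo; [|by apply: Bitv; rewrite su ut|by apply: Bitv; rewrite sv vt].
    by rewrite distrC ger0_norm// mulrDl mul1r lerD2l.
  transitivity (mu `[u, v]%classic); first by [].
  rewrite lebesgue_measure_itv/= lte_fin; case: (ltP u v) => [//|vu].
  have -> : u = v by apply/eqP; rewrite eq_le uv.
  by rewrite subrr.
split; first by left.
(* The strict bound [f b < 1] settles the timelike and the causal version together. *)
have tl0 u : s < u < t -> causal_char d f graph_curve u < 0.
  move=> su; have uitv : s <= u <= t by case/andP: su => /ltW -> /ltW ->.
  rewrite /causal_char alphaE betaE// /calpha /cf /= -exprMn expr1n.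
  have fb0 : 0 <= f u * b u by rewrite mulr_ge0 ?f_ge0//; have /andP[] := b_itv uitv.
  by rewrite addrC subr_lt0 expr_lt1// fb1.
split.
  apply: filterS ae_interior => u H' /H'/tl0; case: tl => // /ltW//.
by apply: filterS ae_interior => u _ _; rewrite alphaE.
Qed.

Lemma graph_curve_length : curve_length d f graph_curve = (H t - H s)%:E.
Proof.
pose q u := Num.sqrt (1 - (f u * b u) ^+ 2).
have cq u : s <= u <= t -> {for u, continuous q}.
  move=> su; apply: continuous_sqrt.
  apply: continuousB; first exact: cvg_cst.
  apply: continuous_sqr.
  by apply: continuousM; [exact: cf_|exact: cb].
have cqw : {within `[s, t], continuous q}.
  apply: continuous_in_subspaceT => u; rewrite inE/= in_itv/=; exact: cq.
have HF : (\int[mu]_(u in `[s, t]) (q u)%:E = (H t)%:E - (H s)%:E)%E.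
  apply: continuous_FTC2 => //.
    split.
    - move=> u; rewrite in_itv/= => /andP[su ut].
      by apply: @ex_derive; apply: dH; rewrite !ltW.
    - by apply: cvg_at_right_filter; apply: is_derive_continuous; apply: dH; rewrite lexx ltW.
    - by apply: cvg_at_left_filter; apply: is_derive_continuous; apply: dH; rewrite lexx ltW.
  move=> u; rewrite in_itv/= => /andP[su ut].
  by rewrite derive1E; apply: derive_val; apply: dH; rewrite !ltW.
rewrite EFinB -HF /curve_length -[Defs.mu (R:=R)]/mu.
have mq : measurable_fun `]s, t[ (EFin \o q).
  have iq : mu.-integrable `[s, t] (EFin \o q).
    by apply: continuous_compact_integrable => //; exact: segment_compact.
  apply: measurable_funS (measurable_int mu iq) => //.
  exact: subset_itv_oo_cc.
have qE u : s < u < t ->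
    Num.sqrt (derive1 (calpha graph_curve) u ^+ 2 -
      f (calpha graph_curve u) ^+ 2 * metric_deriv d (cbeta graph_curve) u ^+ 2) = q u.
  by move=> su; rewrite alphaE betaE// expr1n -exprMn.
rewrite [LHS]integral_itv_bndoo; last first.
  apply: eq_measurable_fun mq => u; rewrite inE/= in_itv/= => /qE /= ->//.
rewrite [RHS]integral_itv_bndoo//.
by apply: eq_integral => u; rewrite inE/= in_itv/= => /qE ->.
Qed.
End CurveConstruction.

(** * Sturm comparison and cross ratios *)

Section CrossRatio.
Variables (R : realType).

Section JacobiField.
Variables (p q : R) (f df k A : R -> R).
Hypothesis f_gt0 : forall u, p <= u <= q -> 0 < f u.
Hypothesis dfP : forall u, p <= u <= q -> is_derive u 1 f (df u).
Hypothesis ddfP : forall u, p <= u <= q -> is_derive u 1 df (k u * f u).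
Hypothesis dA : forall u, p <= u <= q -> is_derive u 1 A ((f u) ^- 2).

(* The solution of [S'' = k S] with [S u = 0] and [S' u = 1]. *)
Definition jacobi (u t : R) := f u * (f t * (A t - A u)).
Definition djacobi (u t : R) := f u * (df t * (A t - A u) + (f t)^-1).

Let fne u : p <= u <= q -> f u != 0.
Proof. by move=> /f_gt0 ?; rewrite gt_eqF. Qed.

Let dAu u t : p <= t <= q -> is_derive t 1 (fun t => A t - A u) ((f t) ^- 2).
Proof. by move=> /dA; exact: is_derive_subr. Qed.

Lemma is_derive_jacobi u t : p <= t <= q -> is_derive t 1 (jacobi u) (djacobi u t).
Proof.
move=> tq; have := dAu u tq => dAt; have := dfP tq => dft.
apply: is_derive_scale; apply: is_derive_eq (is_derive_mul dft dAt) _.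
by field; exact: fne.
Qed.

Lemma is_derive_djacobi u t : p <= t <= q ->
  is_derive t 1 (djacobi u) (k t * jacobi u t).
Proof.
move=> tq; have := dAu u tq => dAt; have := dfP tq => dft; have := ddfP tq => ddft.
apply: is_derive_eq (is_derive_scale _
  (is_derive_add (is_derive_mul ddft dAt) (is_derive_inv (fne tq) dft))) _.
by rewrite /jacobi; field; exact: fne.
Qed.

Lemma antideriv_lt s t : p <= s -> s < t -> t <= q -> A s < A t.
Proof.
move=> ps st tq; rewrite -subr_gt0 -[X in X < _](subrr (0 : R)).
refine (@derive_lt_incr _ (fun=> 0) (fun=> 0) A (fun u => (f u) ^- 2) s t st _ _ _).
- by move=> u /andP[su ut]; apply: dA; rewrite (le_trans ps su) (le_trans ut tq).
- move=> u /andP[su ut]; rewrite invr_gt0 exprn_gt0//; apply: f_gt0.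
  by rewrite (le_trans ps (ltW su)) (le_trans (ltW ut) tq).
Qed.

Lemma jacobi_gt0 u t : p <= u -> u < t -> t <= q -> 0 < jacobi u t.
Proof.
move=> pu ut tq; rewrite /jacobi !mulr_gt0 ?subr_gt0 ?antideriv_lt// f_gt0//.
  by rewrite pu ltW// (lt_le_trans ut).
by rewrite tq ltW// (le_lt_trans pu).
Qed.

Lemma jacobi_self u : jacobi u u = 0.
Proof. by rewrite /jacobi subrr !mulr0. Qed.

Lemma djacobi_self u : p <= u <= q -> djacobi u u = 1.
Proof. by move=> /fne fu; rewrite /djacobi subrr mulr0 add0r divff. Qed.

End JacobiField.

Section Comparison.
Variables (p q : R) (f1 df1 k1 A1 f2 df2 k2 A2 : R -> R).
Hypothesis f1_gt0 : forall u, p <= u <= q -> 0 < f1 u.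
Hypothesis df1P : forall u, p <= u <= q -> is_derive u 1 f1 (df1 u).
Hypothesis ddf1P : forall u, p <= u <= q -> is_derive u 1 df1 (k1 u * f1 u).
Hypothesis dA1 : forall u, p <= u <= q -> is_derive u 1 A1 ((f1 u) ^- 2).
Hypothesis f2_gt0 : forall u, p <= u <= q -> 0 < f2 u.
Hypothesis df2P : forall u, p <= u <= q -> is_derive u 1 f2 (df2 u).
Hypothesis ddf2P : forall u, p <= u <= q -> is_derive u 1 df2 (k2 u * f2 u).
Hypothesis dA2 : forall u, p <= u <= q -> is_derive u 1 A2 ((f2 u) ^- 2).
Hypothesis k21 : forall u, p <= u <= q -> k2 u < k1 u.

Let S1 := jacobi f1 A1.
Let S2 := jacobi f2 A2.
Let D1 := djacobi f1 df1 A1.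
Let D2 := djacobi f2 df2 A2.

(** The Wronskian vanishes at [u] and its derivative [(k1 - k2) S1 S2] is positive afterwards. *)
Let wronskian_gt0 u t : p <= u -> u < t -> t <= q ->
  0 < D1 u t * S2 u t - S1 u t * D2 u t.
Proof.
move=> pu ut tq.
pose Wr v := D1 u v * S2 u v - S1 u v * D2 u v.
have W0 : Wr u = 0 by rewrite /Wr /S1 /S2 !jacobi_self mulr0 mul0r subrr.
suff : (0 : R) - 0 < Wr t - Wr u by rewrite W0 !subr0.
refine (@derive_lt_incr _ (fun=> 0) (fun=> 0) Wr
  (fun v => (k1 v - k2 v) * (S1 u v * S2 u v)) u t ut _ _ _).
  move=> v /andP[uv vt]; have vq : p <= v <= q by rewrite (le_trans pu uv) (le_trans vt tq).
  have := is_derive_jacobi f1_gt0 df1P dA1 u vq; rewrite -/(S1 u) -/(D1 u) => d1.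
  have := is_derive_jacobi f2_gt0 df2P dA2 u vq; rewrite -/(S2 u) -/(D2 u) => d2.
  have := is_derive_djacobi f1_gt0 df1P ddf1P dA1 u vq; rewrite -/(S1 u) -/(D1 u) => dd1.
  have := is_derive_djacobi f2_gt0 df2P ddf2P dA2 u vq; rewrite -/(S2 u) -/(D2 u) => dd2.
  apply: is_derive_eq (is_derive_sub (is_derive_mul dd1 d2) (is_derive_mul d1 dd2)) _.
  ring.
move=> v /andP[uv vt] /=; have vq := le_trans (ltW vt) tq.
rewrite mulr_gt0 ?subr_gt0 ?k21 ?vq ?(le_trans pu (ltW uv))//.
by rewrite mulr_gt0//; [exact: (jacobi_gt0 f1_gt0 dA1)|exact: (jacobi_gt0 f2_gt0 dA2)].
Qed.

(** The derivative of the quotient is the Wronskian divided by [S2^2]. *)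
Let ratio_incr u s t : p <= u -> u < s -> s < t -> t <= q ->
  S1 u s / S2 u s < S1 u t / S2 u t.
Proof.
move=> pu us st tq; rewrite -subr_gt0 -[ltLHS](subrr (0 : R)).
have Sne v : s <= v <= t -> 0 < S2 u v.
  move=> /andP[sv vt]; apply: (jacobi_gt0 f2_gt0 dA2) => //; first exact: lt_le_trans sv.
  exact: le_trans tq.
refine (@derive_lt_incr _ (fun=> 0) (fun=> 0) (fun v => S1 u v / S2 u v)
  (fun v => (D1 u v * S2 u v - S1 u v * D2 u v) / (S2 u v) ^+ 2) s t st _ _ _).
  move=> v vst; have vq : p <= v <= q.
    by case/andP: vst => sv vt; rewrite (le_trans pu (le_trans (ltW us) sv)) (le_trans vt tq).
  have := is_derive_jacobi f1_gt0 df1P dA1 u vq; rewrite -/(S1 u) -/(D1 u) => d1.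
  have := is_derive_jacobi f2_gt0 df2P dA2 u vq; rewrite -/(S2 u) -/(D2 u) => d2.
  have S2ne : S2 u v != 0 by rewrite gt_eqF// Sne.
  apply: is_derive_eq (is_derive_mul d1 (is_derive_inv S2ne d2)) _.
  by field.
move=> v /andP[sv vt] /=; rewrite divr_gt0//.
  by apply: wronskian_gt0 => //; [exact: lt_trans sv|exact: le_trans (ltW vt) tq].
by rewrite exprn_gt0// Sne// !ltW.
Qed.

(** The quotient [S1 / S2] increases from the limit 1 at [u], where both slopes are 1. The limit
    itself is avoided: if [S1 <= S2] at [t], the quotient [r] at the midpoint [m] is below 1 and
    [S1 < r S2] between [u] and [m], against the slope [r - 1 < 0] of [r S2 - S1] at [u]. *)
Lemma sturm_comparison u t : p <= u -> u < t -> t <= q -> S2 u t < S1 u t.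
Proof.
move=> pu ut tq; rewrite ltNge; apply/negP => S12.
pose m := (u + t) / 2.
have [um mt] : u < m /\ m < t by rewrite /m; split; lra.
have S2pos v : u < v -> v <= t -> 0 < S2 u v.
  by move=> uv vt; apply: (jacobi_gt0 f2_gt0 dA2) => //; exact: le_trans tq.
pose r := S1 u m / S2 u m.
have r1 : r < 1.
  apply: lt_le_trans (ratio_incr pu um mt tq) _.
  by rewrite ler_pdivrMr ?mul1r// S2pos.
have uq : p <= u <= q by rewrite pu ltW// (lt_le_trans ut).
have dD : is_derive u 1 (fun v => r * S2 u v - S1 u v) (r - 1).
  have d1 := is_derive_jacobi f1_gt0 df1P dA1 u uq.
  have d2 := is_derive_jacobi f2_gt0 df2P dA2 u uq.
  have E1 : djacobi f1 df1 A1 u u = 1 by exact: (djacobi_self _ _ f1_gt0 uq).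
  have E2 : djacobi f2 df2 A2 u u = 1 by exact: (djacobi_self _ _ f2_gt0 uq).
  rewrite E1 in d1; rewrite E2 in d2.
  by apply: is_derive_eq (is_derive_sub (is_derive_scale r d2) d1) _; rewrite mulr1.
have e0 : 0 < (1 - r) / 2 by rewrite divr_gt0// subr_gt0.
have [dl dl0 H] := (is_derive_epsP _ _ _).1 dD _ e0.
have md0 : 0 < Num.min dl (m - u) by rewrite lt_min dl0 subr_gt0.
pose h := Num.min dl (m - u) / 2.
have h0 : 0 < h by rewrite divr_gt0.
have : h < Num.min dl (m - u) by rewrite /h; lra.
rewrite lt_min => /andP[hdl hm].
have := H h; rewrite (gtr0_norm h0) => /(_ hdl).
rewrite /S1 /S2 !jacobi_self mulr0 subrr subr0 -/(S1 u (u + h)) -/(S2 u (u + h)).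
have uh : u < u + h by rewrite ltrDl.
have hm' : u + h < m by lra.
have S2h : 0 < S2 u (u + h) by apply: S2pos => //; lra.
have : S1 u (u + h) < r * S2 u (u + h).
  by rewrite -ltr_pdivrMr//; apply: ratio_incr => //; lra.
have : 0 < (1 - r) * h by rewrite mulr_gt0// subr_gt0.
by rewrite ler_norml => ? ? /andP[_]; lra.
Qed.

(* [ln (1 + cross ratio)] is the double integral of [1 / S (u, t) ^ 2] over
   [s0, s] x [t0, s2]. *)
Lemma cross_ratio_lt (s0 s t0 s2 : R) :
  p <= s0 -> s0 < s -> s < t0 -> t0 < s2 -> s2 <= q ->
  ((A2 s2 - A2 s) * (A2 t0 - A2 s0)) / ((A2 t0 - A2 s) * (A2 s2 - A2 s0)) >
  ((A1 s2 - A1 s) * (A1 t0 - A1 s0)) / ((A1 t0 - A1 s) * (A1 s2 - A1 s0)).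
Proof.
move=> ps0 s0s st0 t0s2 s2q.
(* The inner integral of [1 / S (s, t)^2] over [t] in [[t0, s2]]. *)
pose M (f A : R -> R) s := (f s) ^- 2 * ((A t0 - A s)^-1 - (A s2 - A s)^-1).
have inc1 := antideriv_lt f1_gt0 dA1; have inc2 := antideriv_lt f2_gt0 dA2.
have MM u : s0 <= u <= s -> M f1 A1 u < M f2 A2 u.
  move=> /andP[s0u us].
  have pu := le_trans ps0 s0u; have ut0 := le_lt_trans us st0.
  have dM (f A : R -> R) : (forall u, p <= u <= q -> 0 < f u) ->
    (forall u, p <= u <= q -> is_derive u 1 A ((f u) ^- 2)) ->
    forall t, t0 <= t <= s2 ->
    is_derive t 1 (fun t => (f u) ^- 2 * (- (A t - A u)^-1)) ((jacobi f A u t) ^- 2).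
    move=> f0 dA t /andP[t0t ts2].
    have pt : p <= t <= q by rewrite (le_trans pu (le_trans (ltW ut0) t0t)) (le_trans ts2 s2q).
    have fu : f u != 0.
      by rewrite gt_eqF// f0// pu (le_trans (ltW ut0))// (le_trans (ltW t0s2)).
    have ft : f t != 0 by rewrite gt_eqF// f0.
    have ane : A t - A u != 0.
      rewrite gt_eqF// subr_gt0; apply: (antideriv_lt f0 dA) => //; last by case/andP: pt.
      exact: lt_le_trans t0t.
    have dAt := is_derive_subr (A u) (dA t pt).
    have D := is_derive_scale ((f u) ^- 2) 
      (is_derive_opp (is_derive_inv (f := fun t => A t - A u) ane dAt)).
    apply: is_derive_eq D _.
    by rewrite /jacobi; field; rewrite fu ft ane.
  have := derive_lt_incr t0s2 (dM _ _ f1_gt0 dA1) (dM _ _ f2_gt0 dA2).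
  have HS t : t0 < t < s2 -> (jacobi f1 A1 u t) ^- 2 < (jacobi f2 A2 u t) ^- 2.
    move=> /andP[t0t ts2]; have ut := lt_trans ut0 t0t; have tq := le_trans (ltW ts2) s2q.
    have J2 := jacobi_gt0 f2_gt0 dA2 pu ut tq.
    have J1 := jacobi_gt0 f1_gt0 dA1 pu ut tq.
    rewrite ltf_pV2 ?posrE ?exprn_gt0// ltr_pXn2r// ?nnegrE ?(ltW J1) ?(ltW J2)//.
    exact: sturm_comparison.
  by move=> /(_ HS); rewrite /M; lra.
have Apos (A : R -> R) : (forall s t, p <= s -> s < t -> t <= q -> A s < A t) ->
    forall u, s0 <= u <= s -> 0 < A t0 - A u /\ 0 < A s2 - A u.
  move=> inc u /andP[s0u us]; have ut0 := le_lt_trans us st0; have pu := le_trans ps0 s0u.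
  rewrite !subr_gt0; split; apply: inc => //.
    exact: le_trans (ltW t0s2) s2q.
  exact: lt_trans t0s2.
(* An antiderivative of [M], so its increment over [[s0, s]] is the outer integral. *)
pose L (A : R -> R) u := ln (A s2 - A u) - ln (A t0 - A u).
have dL (f A : R -> R) : (forall s t, p <= s -> s < t -> t <= q -> A s < A t) ->
    (forall u, p <= u <= q -> is_derive u 1 A ((f u) ^- 2)) ->
    forall u, s0 <= u <= s -> is_derive u 1 (L A) (M f A u).
  move=> inc dA u us; have [P1 P2] := Apos A inc u us.
  have uq : p <= u <= q.
    case/andP: us => s0u us; rewrite (le_trans ps0 s0u)/=.
    by rewrite (le_trans us)// ltW// (lt_le_trans (lt_trans st0 t0s2)).
  have dln (c : R) : 0 < A c - A u ->
      is_derive u 1 (fun u => ln (A c - A u)) ((A c - A u)^-1 * - (f u) ^- 2).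
    move=> Pc; have dAc := is_derive_rsub (A c) (dA u uq).
    exact: is_derive_comp dAc (is_derive1_ln Pc).
  apply: is_derive_eq (is_derive_sub (dln _ P2) (dln _ P1)) _.
  by rewrite /M; ring.
have := derive_lt_incr s0s (dL _ _ inc1 dA1) (dL _ _ inc2 dA2).
have HM u : s0 < u < s -> M f1 A1 u < M f2 A2 u.
  by move=> /andP[/ltW ? /ltW ?]; apply: MM; apply/andP.
move=> /(_ HM).
have LE (A : R -> R) : (forall s t, p <= s -> s < t -> t <= q -> A s < A t) ->
    0 < ((A s2 - A s) * (A t0 - A s0)) / ((A t0 - A s) * (A s2 - A s0)) /\
    L A s - L A s0 = ln (((A s2 - A s) * (A t0 - A s0)) / ((A t0 - A s) * (A s2 - A s0))).
  move=> inc.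
  have [|P1 P2] := Apos A inc s0; first by rewrite lexx ltW.
  have [|P3 P4] := Apos A inc s; first by rewrite lexx ltW.
  split; first by rewrite divr_gt0// mulr_gt0.
  rewrite ln_div ?posrE ?mulr_gt0// !lnM ?posrE//; rewrite /L; ring.
have [P1 ->] := LE _ inc1; have [P2 ->] := LE _ inc2.
by rewrite ltr_ln.
Qed.

End Comparison.

(** In the notation of the expansions this evaluates [(be - al1) / (al1 + al2)], which is how cross
    ratios enter. *)
Lemma cross_ratio_harmonic (a0 a1 a2 a3 : R) : a0 < a1 -> a1 < a2 -> a2 < a3 ->
  (2 * (a2 - a1))^-1 - (2 * (a2 - a0))^-1 =
  (((a3 - a1) * (a2 - a0)) / ((a2 - a1) * (a3 - a0)) - 1) *
  ((2 * (a2 - a0))^-1 + (2 * (a3 - a2))^-1).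
Proof.
move=> h1 h2 h3.
have n1 : a2 - a1 != 0 by rewrite subr_eq0 gt_eqF.
have n2 : a2 - a0 != 0 by rewrite subr_eq0 gt_eqF// (lt_trans h1).
have n3 : a3 - a2 != 0 by rewrite subr_eq0 gt_eqF.
have n4 : a3 - a0 != 0 by rewrite subr_eq0 gt_eqF// (lt_trans h1)// (lt_trans h2).
by field; rewrite n1 n2 n3 n4.
Qed.

(* [u] and [mu] are the squared horizontal displacements in the two spaces, [dl] and
   [dl'] the time displacements of the middle vertex, [P] and [Q] the common lengths of
   the two short sides, and [Ra], [Rb] the separations that are compared. *)
Lemma expansion_limit (T S e0 al1 al2 be al1' al2' be' : R) :
  0 < e0 -> 0 <= be - al1 -> 0 <= be' - al1' -> 0 < al1 + al2 -> 0 < al1' + al2' ->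
  (forall eta, 0 < eta -> eta < e0 -> exists u mu dl dl' P Q Ra Rb : R,
    [/\ 0 <= u, 0 <= mu & 0 < u + mu] /\
    [/\ `|P - (T + dl - u * al1)| <= eta * u,
        `|Q - (T - dl - u * al2)| <= eta * u &
        `|Ra - (S + dl - u * be)| <= eta * u] /\
    [/\ `|P - (T + dl' - mu * al1')| <= eta * mu,
        `|Q - (T - dl' - mu * al2')| <= eta * mu &
        `|Rb - (S + dl' - mu * be')| <= eta * mu] /\ Ra <= Rb) ->
  (al1 + al2) * (be' - al1') <= (al1' + al2') * (be - al1).
Proof.
move=> e00 g0 g0' k0 k0' H.
set ka := al1 + al2 in k0 *; set ka' := al1' + al2' in k0' *.
set ga := be - al1 in g0 *; set ga' := be' - al1' in g0' *.
pose C := ka + ka' + ga + ga'.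
have C0 : 0 < C by rewrite /C; lra.
apply/ler_addgt0Pr => e e_gt0.
have [|eta et0 /= /and3P[et1 et2 _]] := @pos_lower_bound R [:: e0 / 2; e / (2 * C)].
  by rewrite /= !divr_gt0// mulr_gt0.
have ete0 : eta < e0 by move: et1 e00; clear; lra.
have [u [mu [dl [dl' [P [Q [Ra [Rb H']]]]]]]] := H eta et0 ete0.
have [[u0 mu0 w0] [[P1 Q1 R1] [[P2 Q2 R2] Rab]]] := H'.
clear H H'.
move: P1 Q1 R1 P2 Q2 R2; rewrite !ler_norml => /andP[P1 P1'] /andP[Q1 Q1'] /andP[R1 _]
  /andP[P2 P2'] /andP[Q2 Q2'] /andP[_ R2].
(* [P + Q] is free of the time displacements, and in [F2] so are [Ra - P] and [Rb - P]. *)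
have F1 : u * ka <= mu * ka' + 2 * (eta * (u + mu)).
  by move: P1 Q1 P1' Q1' P2 Q2 P2' Q2'; rewrite /ka /ka'; clear; lra.
have F2 : mu * ga' <= u * ga + 2 * (eta * (u + mu)).
  by move: R1 P1' R2 P2 Rab; rewrite /ga /ga'; clear; lra.
(* Eliminating [mu] bounds [u (ka ga' - ka' ga)], and eliminating [u] bounds the same difference
   times [mu]. The sum can be divided by [u + mu], with no lower bound on either displacement. *)
have G1 := ler_wpM2r g0' F1; have G2 := ler_wpM2l (ltW k0') F2.
have G3 := ler_wpM2l (ltW k0) F2; have G4 := ler_wpM2r g0 F1.
have : (u + mu) * (ka * ga' - ka' * ga) <= 2 * (eta * (u + mu)) * C.
  by move: G1 G2 G3 G4; rewrite /C; clear; lra.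
have -> : 2 * (eta * (u + mu)) * C = (u + mu) * (eta * (2 * C)) by ring.
rewrite (ler_pM2l w0) => K.
have : eta * (2 * C) <= e by rewrite -ler_pdivlMr// mulr_gt0.
by move: K; clear; lra.
Qed.

End CrossRatio.

(** * Time separation *)

Section SeparationBounds.
Variables (R : realType).

(** What the estimates use of a warping function on a compact time interval; the same estimates then
    serve [Y] and the model. *)
Definition window (I : set R) (f : R -> R) (p q b : R) : Prop :=
  0 < b /\ forall u, p <= u <= q -> [/\ I u, b <= f u & {for u, continuous f}].

Variables (X : Type) (d : X -> X -> R) (I : set R) (f : R -> R).
Hypothesis dm : is_metric d.
Hypothesis dgeo : geodesic_space d.

Lemma tsep_eq0 y y' : y'.1 <= y.1 -> tsep d I f y y' = 0%E.
Proof.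
move=> yy'; rewrite /tsep (_ : [set l | _] = set0) ?setU0 ?ereal_sup1//.
by apply/seteqP; split=> // l /= [g [/fd_curve_lt]]; rewrite ltNge yy'.
Qed.

Section Window.
Variables (p q b : R).
Hypothesis W : window I f p q b.

Lemma tsep_le (s t c M : R) (G : R -> R) (x y : X) :
  p <= s -> t <= q -> 0 <= c -> 0 <= M ->
  (forall u, s <= u <= t -> is_derive u 1 G (Num.sqrt (1 + (c / f u) ^+ 2))) ->
  G t - G s - c * d x y <= M -> (tsep d I f (s, x) (t, y) <= M%:E)%E.
Proof.
move=> ps tq c0 M0 dG GM; have [b0 Wp] := W.
apply: ge_ereal_sup => l /= [->|[g [fd ->]]]; first by rewrite lee_fin.
have fb u : s <= u <= t -> b <= f u.
  by move=> /andP[su ut]; have [|//] := Wp u; rewrite (le_trans ps su) (le_trans ut tq).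
by apply: le_trans (curve_length_le dm c0 b0 fd fb dG) _; rewrite lee_fin.
Qed.

Lemma tsep_ge (s t N : R) (B v H : R -> R) (x y : X) :
  p <= s -> s < t -> t <= q ->
  (forall u, s <= u <= t -> is_derive u 1 B (v u)) -> B s = 0 -> B t = d x y ->
  (forall u, s <= u <= t -> [/\ 0 <= v u <= N, f u * v u < 1 & {for u, continuous v}]) ->
  (forall u, s <= u <= t -> is_derive u 1 H (Num.sqrt (1 - (f u * v u) ^+ 2))) ->
  tl_rel d I f (s, x) (t, y) /\ c_rel d I f (s, x) (t, y) /\
  ((H t - H s)%:E <= tsep d I f (s, x) (t, y))%E.
Proof.
move=> ps st tq dB Bs Bt Hv dH; have [b0 Wp] := W.
have [c [c0 [cl ciso]]] := dgeo x y.
have Wu u : s <= u <= t -> [/\ I u, 0 <= f u & {for u, continuous f}].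
  move=> /andP[su ut]; have [|? bf ?] := Wp u; first by rewrite (le_trans ps su) (le_trans ut tq).
  by split => //; apply: le_trans bf; exact: ltW.
have fd tl : fd_curve d I f tl (s, x) (t, y) (graph_curve s t c B).
  rewrite -[in (s, x)]c0 -[in (t, y)]cl.
  by apply: (graph_curve_fd (b := v) (N := N)) => //; move=> u /[dup]/Hv[? ? ?] /Wu[? ? ?].
have len : curve_length d f (graph_curve s t c B) = (H t - H s)%:E.
  apply: (graph_curve_length (b := v) (N := N) (l := d x y)) => //;
    by move=> u /[dup]/Hv[? ? ?] /Wu[? ? ?].
split; first by exists (graph_curve s t c B).
split; first by exists (graph_curve s t c B).
by apply: ereal_sup_ubound; right; exists (graph_curve s t c B).
Qed.

End Window.
End SeparationBounds.

Section SeparationAsymptotics.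
Variables (R : realType) (X : Type) (d : X -> X -> R) (I : set R) (f : R -> R).
Hypothesis dm : is_metric d.
Variables (p q b : R).
Hypothesis W : window I f p q b.

Definition vertical_curve (s t : R) (x : X) : curveT R X := (s, t, fun u => (u, x)).

(** Momentum 0: the lift of a constant geodesic, calibrated by time itself. *)
Lemma vertical_curveP (s t : R) (x : X) : p <= s -> s < t -> t <= q ->
  [/\ forall tl, fd_curve d I f tl (s, x) (t, x) (vertical_curve s t x),
      curve_length d f (vertical_curve s t x) = (t - s)%:E &
      tsep d I f (s, x) (t, x) = (t - s)%:E].
Proof.
move=> ps st tq; have [b0 Wp] := W; have [d0 [deq _]] := dm.
have dxx : d x x = 0 by exact/deq.
have Wu u : s <= u <= t -> [/\ I u, 0 <= f u & {for u, continuous f}].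
  move=> /andP[su ut]; have [|? bf ?] := Wp u; first by rewrite (le_trans ps su) (le_trans ut tq).
  by split => //; apply: le_trans bf; exact: ltW.
have geo (u v : R) : 0 <= u <= 0 -> 0 <= v <= 0 -> d x x = `|u - v|.
  by move=> /le_anti <- /le_anti <-; rewrite subrr normr0.
have fd tl : fd_curve d I f tl (s, x) (t, x) (vertical_curve s t x).
  apply: (@graph_curve_fd R X d I f s t 0 0 (fun=> x) (fun=> 0) (fun=> 0)) => //.
  - by move=> u /Wu[].
  - by move=> u _; rewrite lexx.
  - by move=> u /Wu[].
  - by move=> u _; rewrite /= mulr0.
have len : curve_length d f (vertical_curve s t x) = (t - s)%:E.
  apply: (@graph_curve_length R X d f s t 0 0 (fun=> x) (fun=> 0) (fun=> 0) id) => //.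
  - by move=> u _; rewrite lexx.
  - by move=> u /Wu[].
  - by move=> u _; exact: cvg_cst.
  - by move=> u _; rewrite /= mulr0 expr0n subr0 sqrtr1; exact: is_derive_id.
split => //; apply/eqP; rewrite eq_le; apply/andP; split.
  apply: (tsep_le dm W (c := 0) (G := id)) => //.
  - by rewrite subr_ge0 ltW.
  - by move=> u _; rewrite mul0r expr0n addr0 sqrtr1; exact: is_derive_id.
  - by rewrite mul0r subr0.
by rewrite -len; apply: ereal_sup_ubound; right; exists (vertical_curve s t x).
Qed.

Hypothesis dgeo : geodesic_space d.
Variable A : R -> R.
Hypothesis dA : forall u, p <= u <= q -> is_derive u 1 A ((f u) ^- 2).

Let sub (s t u : R) : p <= s -> t <= q -> s <= u <= t -> p <= u <= q.
Proof. by move=> ps tq /andP[su ut]; rewrite (le_trans ps su) (le_trans ut tq). Qed.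

Let fbnd u : p <= u <= q -> [/\ b <= f u, 0 < f u & 0 <= (f u) ^- 2 <= b ^- 2].
Proof.
have [b0 Wp] := W; move=> /Wp[_ bf _]; have f0 := lt_le_trans b0 bf; split=> //.
rewrite invr_ge0 exprn_ge0 ?(ltW f0)//= lef_pV2 ?posrE ?exprn_gt0//.
by rewrite ler_pXn2r// nnegrE ltW.
Qed.

Lemma antideriv_gt0 s t : p <= s -> s < t -> t <= q -> 0 < A t - A s.
Proof.
move=> ps st tq; rewrite subr_gt0.
by apply: (antideriv_lt _ dA ps st tq) => u /fbnd[].
Qed.

(** Since [sqrt (1 + k) <= 1 + k / 2], the calibration of momentum [c] gives at most
    [t - s + c^2 a / 2 - c l], minimal at [c = l / a]. The hypothesis on [l] keeps the bound
    nonnegative, as [tau] always is. *)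
Lemma tsep_upper s t x y : p <= s -> s < t -> t <= q ->
  let a := A t - A s in let l := d x y in
  l ^+ 2 <= 2 * a * (t - s) ->
  (tsep d I f (s, x) (t, y) <= (t - s - l ^+ 2 / (2 * a))%:E)%E.
Proof.
move=> ps st tq a l la; have [b0 Wp] := W; have [d0 _] := dm.
have a0 : 0 < a by exact: antideriv_gt0.
have l0 : 0 <= l by exact: d0.
pose c := l / a.
have c0 : 0 <= c by rewrite divr_ge0// ltW.
have fne u : p <= u <= q -> f u != 0 by move=> /fbnd[_ ? _]; rewrite gt_eqF.
have [G dG] : exists G : R -> R, forall u, s <= u <= t ->
    is_derive u 1 G (Num.sqrt (1 + (c / f u) ^+ 2)).
  apply: antiderivative (ltW st) _ => u /(sub ps tq) uq; have [_ _ cf] := Wp u uq.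
  apply: continuous_sqrt.
  apply: continuousD; first exact: cvg_cst.
  apply: continuous_sqr.
  apply: continuousM; first exact: cvg_cst.
  by apply: continuousV => //; exact: fne.
have cE : c * l = l ^+ 2 / a by rewrite /c expr2 mulrAC.
have E2 : l ^+ 2 / (2 * a) = l ^+ 2 / a / 2 by rewrite invfM mulrA mulrAC.
apply: (tsep_le dm W (c := c) (G := G)) => //.
  by rewrite subr_ge0 ler_pdivrMr ?mulr_gt0//; lra.
have H : G t - G s <= (t + c ^+ 2 / 2 * A t) - (s + c ^+ 2 / 2 * A s).
  refine (@derive_le_incr _ G _ (fun u => u + c ^+ 2 / 2 * A u)
     (fun u => 1 + c ^+ 2 / 2 * (f u) ^- 2) s t (ltW st) dG _ _).
    move=> u /(sub ps tq)/dA dAu.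
    by apply: is_deriveD; apply: is_deriveZ.
  move=> u /(sub ps tq) uq; have [_ f0 _] := fbnd uq.
  have k0 : 0 <= c ^+ 2 * (f u) ^- 2 by rewrite mulr_ge0 ?invr_ge0 ?exprn_ge0 ?(ltW f0).
  have k1 : 0 <= 1 + c ^+ 2 / 2 * (f u) ^- 2 by lra.
  rewrite -(ger0_norm k1) -sqrtr_sqr ler_sqrt ?sqr_ge0// expr_div_n.
  set k := c ^+ 2 * _ in k0 *; have -> : c ^+ 2 / 2 * (f u) ^- 2 = k / 2 by rewrite /k; ring.
  by nra.
have c2 : c ^+ 2 * a = l ^+ 2 / a.
  by rewrite /c; field; rewrite gt_eqF.
rewrite cE E2; move: H c2; rewrite /a; lra.
Qed.

(** The lift with speed [c f^-2], the leading term of a maximizer of momentum [c]; [c = l / a] gives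
    the displacement [l], and [l < a b] makes the curve timelike. The length is estimated by
    [sqrt (1 - w) >= 1 - w / 2 - w^2 / 2] on [[0, 1]]. *)
Lemma tsep_lower s t x y : p <= s -> s < t -> t <= q ->
  let a := A t - A s in let l := d x y in
  l < a * b ->
  [/\ tl_rel d I f (s, x) (t, y), c_rel d I f (s, x) (t, y) &
  ((t - s - l ^+ 2 / (2 * a) - l ^+ 4 * b ^- 2 / (2 * a ^+ 3))%:E <= tsep d I f (s, x) (t, y))%E].
Proof.
move=> ps st tq a l la; have [b0 Wp] := W; have [d0 _] := dm.
have a0 : 0 < a by exact: antideriv_gt0.
have l0 : 0 <= l by exact: d0.
pose c := l / a.
have c0 : 0 <= c by rewrite divr_ge0// ltW.
have cb : c < b by rewrite ltr_pdivrMr// mulrC.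
have fne u : p <= u <= q -> f u != 0 by move=> /fbnd[_ ? _]; rewrite gt_eqF.
pose v u := c * (f u) ^- 2.
have cv u : p <= u <= q -> {for u, continuous v}.
  move=> uq; have [_ _ cf] := Wp u uq; apply: continuousM; first exact: cvg_cst.
  apply: continuousV; first by rewrite expf_neq0// fne.
  exact: continuous_sqr.
have fvE u : p <= u <= q -> f u * v u = c / f u.
  by move=> /fne ?; rewrite /v; field.
have fv1 u : p <= u <= q -> 0 <= f u * v u < 1.
  move=> uq; rewrite fvE//; have [bf f0 _] := fbnd uq.
  by rewrite divr_ge0 ?(ltW f0)//= ltr_pdivrMr// mul1r (lt_le_trans cb).
have [H dH] : exists H : R -> R, forall u, s <= u <= t ->
    is_derive u 1 H (Num.sqrt (1 - (f u * v u) ^+ 2)).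
  apply: antiderivative (ltW st) _ => u /(sub ps tq) uq; have [_ _ cf] := Wp u uq.
  apply: continuous_sqrt.
  apply: continuousB; first exact: cvg_cst.
  apply: continuous_sqr.
  by apply: continuousM => //; exact: cv.
have [| | | |tr [cr Hle]] := tsep_ge dgeo W (N := c * b ^- 2)
    (B := fun u => c * (A u - A s)) (v := v) (H := H) (x := x) (y := y) ps st tq _ _ _ _ dH.
- move=> u /(sub ps tq)/dA dAu; apply: is_deriveZ.
  rewrite -[X in is_derive _ _ _ X]subr0; exact: is_deriveB.
- by rewrite subrr mulr0.
- by rewrite -/a -/l /c divfK// gt_eqF.
- move=> u /(sub ps tq) uq; have [_ f0 /andP[f1 f2]] := fbnd uq.
  split; [|by case/andP: (fv1 u uq)|exact: cv].
  by rewrite /v mulr_ge0//= ler_wpM2l.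
split => //; apply: le_trans Hle; rewrite lee_fin.
(* In [w^2] one factor [f^-2] is kept and the other bounded by [b^-2], so that both terms integrate
   to multiples of [a]. *)
pose k := c ^+ 2 / 2 + c ^+ 4 * b ^- 2 / 2.
have HH : (t - k * A t) - (s - k * A s) <= H t - H s.
  refine (@derive_le_incr _ (fun u => u - k * A u) (fun u => 1 - k * (f u) ^- 2)
    _ _ s t (ltW st) _ dH _).
    move=> u /(sub ps tq)/dA dAu.
    by apply: is_deriveB; apply: is_deriveZ.
  move=> u /(sub ps tq) uq; have [_ f0 /andP[f1 f2]] := fbnd uq.
  have /andP[fv0 fv1'] := fv1 u uq.
  set w := (f u * v u) ^+ 2.
  have w0 : 0 <= w by exact: sqr_ge0.
  have w1 : w <= 1 by rewrite /w expr_le1// ltW.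
  have wE : w = c ^+ 2 * (f u) ^- 2 by rewrite /w fvE// expr_div_n.
  apply: (@le_trans _ _ (1 - w / 2 - w ^+ 2 / 2)).
    have : w ^+ 2 <= c ^+ 4 * b ^- 2 * (f u) ^- 2.
      rewrite wE exprMn -exprM expr2 mulrA -mulrA -[leRHS]mulrA ler_wpM2l ?exprn_ge0//.
      by rewrite ler_wpM2r.
    by rewrite /k wE; lra.
  have h0 : 0 <= 1 - w / 2 - w ^+ 2 / 2 by nra.
  rewrite -(ger0_norm h0) -sqrtr_sqr ler_sqrt ?subr_ge0//.
  have : 0 <= w ^+ 2 * (3 - 2 * w - w ^+ 2) by rewrite mulr_ge0 ?exprn_ge0//; nra.
  have -> : (1 - w / 2 - w ^+ 2 / 2) ^+ 2 = 1 - w - w ^+ 2 * (3 - 2 * w - w ^+ 2) / 4 by field.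
  lra.
apply: le_trans HH.
have E1 : k * a = l ^+ 2 / (2 * a) + l ^+ 4 * b ^- 2 / (2 * a ^+ 3).
  by rewrite /k /c; field; rewrite !gt_eqF.
by move: E1; rewrite /a; lra.
Qed.

End SeparationAsymptotics.

Section SeparationExpansion.
Variables (R : realType) (X : Type) (d : X -> X -> R) (I : set R) (f : R -> R).
Hypothesis dm : is_metric d.
Hypothesis dgeo : geodesic_space d.
Variables (p q b : R).
Hypothesis W : window I f p q b.

Section Expansion.
Variable A : R -> R.
Hypothesis dA : forall u, p <= u <= q -> is_derive u 1 A ((f u) ^- 2).

Let A_close u k : p <= u <= q -> 0 < k -> exists2 dl, 0 < dl &
  forall u', `|u' - u| < dl -> `|A u' - A u| <= k.
Proof.
move=> uq k0; have /cvgrPdist_le/(_ k k0)[dl dl0 H] := is_derive_continuous (dA uq).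
exists dl => // u' hu; rewrite distrC; apply: H.
by rewrite /= /ball_ /= distrC.
Qed.

(** The coefficient is frozen at [(s, t)] although the end points vary, because the middle vertex
    moves with the displacement. Freezing costs half of [eta l^2], and the quartic term of the lower
    bound the other half. *)
Lemma tsep_expansion (s t eta : R) : p < s -> s < t -> t < q -> 0 < eta ->
  exists2 e, 0 < e & forall s' t' x y, `|s' - s| < e -> `|t' - t| < e -> d x y < e ->
    [/\ tl_rel d I f (s', x) (t', y), c_rel d I f (s', x) (t', y) &
     exists2 v, tsep d I f (s', x) (t', y) = v%:E &
       `|v - (t' - s' - d x y ^+ 2 / (2 * (A t - A s)))| <= eta * d x y ^+ 2].
Proof.
move=> ps st tq eta0; have [b0 Wp] := W; have [d0 _] := dm.
set a0 := A t - A s.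
have a00 : 0 < a0 by apply: (antideriv_gt0 W dA); rewrite ?ltW.
pose k := Num.min (a0 / 4) (eta * a0 ^+ 2 / 4).
have k0 : 0 < k by rewrite lt_min !divr_gt0// mulr_gt0// exprn_gt0.
have [|d1 d10 H1] := @A_close s k _ k0; first by rewrite !ltW// (lt_trans st).
have [|d2 d20 H2] := @A_close t k _ k0; first by rewrite !ltW// (lt_trans ps).
(* In order: [A] varies by at most [k] at either end, the times stay in the window and at least
   [(t - s) / 2] apart, [l^2 <= l], the hypotheses of the lower and upper bounds hold, and the
   quartic term is small. *)
have [|e e0 /= /and5P[e1 e2 e3 e4 /and5P[e5 e6 e7 e8 /andP[e9 _]]]] := @pos_lower_bound R
    [:: d1; d2; s - p; q - t; (t - s) / 4; 1; a0 / 2 * b; a0 * ((t - s) / 2);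
       eta * (a0 / 2) ^+ 3 * b ^+ 2].
  have ts0 : 0 < t - s by rewrite subr_gt0.
  have h0 : 0 < a0 / 2 by rewrite divr_gt0.
  rewrite /= d10 d20 ![0 < _ - _]subr_gt0 ps tq ltr01 divr_gt0// mulr_gt0//.
  by rewrite mulr_gt0 ?divr_gt0// mulr_gt0 ?exprn_gt0// mulr_gt0 ?exprn_gt0.
exists e => // s' t' x y s's t't; set l := d x y => le.
have l0 : 0 <= l by exact: d0.
have {}H1 := H1 _ (lt_le_trans s's e1); have {}H2 := H2 _ (lt_le_trans t't e2).
move: s's t't; rewrite !ltr_norml => /andP[s'1 s'2] /andP[t'1 t'2].
have ps' : p <= s' by lra.
have t'q : t' <= q by lra.
have st' : (t - s) / 2 <= t' - s' by lra.
have s't' : s' < t' by lra.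
set a := A t' - A s'.
have [k1 k2] : k <= a0 / 4 /\ k <= eta * a0 ^+ 2 / 4 by split; rewrite /k ge_min lexx ?orbT.
move: H1 H2; rewrite !ler_norml => /andP[A1 A2] /andP[A3 A4].
have al : a0 - 2 * k <= a by rewrite /a /a0; lra.
have ar : a <= a0 + 2 * k by rewrite /a /a0; lra.
have ah : a0 / 2 <= a by lra.
have a_gt0 : 0 < a by lra.
have ll : l ^+ 2 <= l by rewrite expr2; nra.
have l20 : 0 <= l ^+ 2 by exact: sqr_ge0.
have up := tsep_upper dm W dA (x := x) (y := y) ps' s't' t'q.
have [|tl cr lo] := tsep_lower dm W dgeo dA (x := x) (y := y) ps' s't' t'q.
  rewrite -/a -/l; apply: lt_le_trans le _; apply: le_trans e7 _.
  by rewrite ler_pM2r.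
split => //.
have {}up : (tsep d I f (s', x) (t', y) <= (t' - s' - l ^+ 2 / (2 * a))%:E)%E.
  apply: up; rewrite -/a -/l.
  apply: le_trans ll _; apply: le_trans (ltW le) _; apply: le_trans e8 _.
  by apply: ler_pM => //; [exact: ltW|rewrite divr_ge0// subr_ge0 ltW|lra].
rewrite -/a -/l in lo.
have vfin : tsep d I f (s', x) (t', y) \is a fin_num.
  by rewrite fin_numE; apply/andP; split; apply/eqP => E; move: up lo; rewrite E.
exists (fine (tsep d I f (s', x) (t', y))); first by rewrite fineK.
rewrite -(fineK vfin) !lee_fin in up lo.
set v := fine _ in up lo *.
have rr : `|(2 * a)^-1 - (2 * a0)^-1| <= eta / 2.
  have -> : (2 * a)^-1 - (2 * a0)^-1 = (a0 - a) / (2 * a * a0).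
    by field; rewrite !gt_eqF.
  have den0 : 0 < 2 * a * a0 by rewrite !mulr_gt0.
  rewrite normrM normfV (gtr0_norm den0) ler_pdivrMr//.
  apply: (@le_trans _ _ (2 * k)); first by rewrite ler_norml; apply/andP; split; lra.
  apply: (@le_trans _ _ (eta / 2 * (a0 * a0))).
    by move: k2; rewrite expr2; lra.
  by rewrite ler_wpM2l ?divr_ge0 ?(ltW eta0)// ler_wpM2r ?(ltW a00)//; lra.
have er : l ^+ 4 * b ^- 2 / (2 * a ^+ 3) <= eta / 2 * l ^+ 2.
  have -> : l ^+ 4 * b ^- 2 / (2 * a ^+ 3) = l ^+ 2 / 2 * (l ^+ 2 / (a ^+ 3 * b ^+ 2)).
    by field; rewrite !gt_eqF.
  have -> : eta / 2 * l ^+ 2 = l ^+ 2 / 2 * eta by ring.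
  rewrite ler_wpM2l ?divr_ge0// ler_pdivrMr ?mulr_gt0 ?exprn_gt0//.
  apply: le_trans ll _; apply: le_trans (ltW le) _; apply: le_trans e9 _.
  have b20 : 0 <= b ^+ 2 by exact: sqr_ge0.
  have h0 : 0 <= a0 / 2 by rewrite divr_ge0// ltW.
  rewrite -mulrA ler_wpM2l ?(ltW eta0)// ler_wpM2r//.
  by rewrite ler_pXn2r// nnegrE ltW.
rewrite -!/a -!/a0 in up lo rr er *.
have : `|l ^+ 2 * (2 * a)^-1 - l ^+ 2 * (2 * a0)^-1| <= l ^+ 2 * (eta / 2).
  by rewrite -mulrBr normrM ger0_norm// ler_wpM2l.
rewrite !ler_norml => /andP[? ?]; apply/andP; split; lra.
Qed.

End Expansion.

(* A maximizer has constant momentum [c = f^2 B' / sqrt (1 - (f B')^2)]; solving for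
   [B'] gives the formulas below, and [E + c B] is the matching calibration. *)
Lemma tsep_momentum (s t c : R) (B E : R -> R) (x y : X) :
  p <= s -> s < t -> t <= q -> 0 <= c ->
  (forall u, p <= u <= q -> is_derive u 1 B (c / (f u * Num.sqrt ((f u) ^+ 2 + c ^+ 2)))) ->
  (forall u, p <= u <= q -> is_derive u 1 E (f u / Num.sqrt ((f u) ^+ 2 + c ^+ 2))) ->
  d x y = B t - B s ->
  [/\ tl_rel d I f (s, x) (t, y), c_rel d I f (s, x) (t, y) &
      tsep d I f (s, x) (t, y) = (E t - E s)%:E].
Proof.
move=> ps st tq c0 dB dE dxy; have [b0 Wp] := W.
have sub u : s <= u <= t -> p <= u <= q.
  by move=> /andP[su ut]; rewrite (le_trans ps su) (le_trans ut tq).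
pose S u := Num.sqrt ((f u) ^+ 2 + c ^+ 2).
have fS u : p <= u <= q -> [/\ 0 < f u, 0 < S u, c < S u & (S u) ^+ 2 = (f u) ^+ 2 + c ^+ 2].
  move=> /Wp[_ bf _]; have f0 := lt_le_trans b0 bf.
  have f2 : 0 < (f u) ^+ 2 by rewrite exprn_gt0.
  have c2 : 0 <= c ^+ 2 by exact: sqr_ge0.
  split=> //; first by rewrite sqrtr_gt0; lra.
    rewrite -[ltLHS](ger0_norm c0) -sqrtr_sqr ltr_sqrt; lra.
  by rewrite sqr_sqrtr//; lra.
have cS u : p <= u <= q -> {for u, continuous S}.
  move=> /Wp[_ _ cf].
  apply: continuous_sqrt.
  apply: continuousD; last exact: cvg_cst.
  exact: continuous_sqr.
pose v u := c / (f u * S u).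
have [|||||tr [cr Hle]] := tsep_ge dgeo W (N := b^-1) (B := fun u => B u - B s) (v := v)
    (H := E) (x := x) (y := y) ps st tq.
- move=> u /sub/dB dBu; rewrite -[X in is_derive _ _ _ X]subr0; exact: is_deriveB.
- by rewrite subrr.
- by [].
- move=> u /sub uq; have [_ bf cf] := Wp u uq; have [f0 S0 cltS S2] := fS u uq.
  split.
  + rewrite /v divr_ge0//=; last by rewrite mulr_ge0// ltW.
    rewrite invfM mulrA mulrAC -[leRHS]mul1r ler_pM//.
    * by rewrite divr_ge0// ltW.
    * by rewrite invr_ge0 ltW.
    * by rewrite ler_pdivrMr// mul1r ltW.
    * by rewrite lef_pV2.
  + rewrite /v invfM mulrCA mulVKf ?gt_eqF// -?mulrA.
    by rewrite ltr_pdivrMr// mul1r.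
  + apply: continuousM; first exact: cvg_cst.
    apply: continuousV; first by rewrite mulf_neq0// gt_eqF.
    by apply: continuousM => //; exact: cS.
- move=> u /sub uq; have [f0 S0 cltS S2] := fS u uq.
  suff -> : Num.sqrt (1 - (f u * v u) ^+ 2) = f u / S u by exact: dE.
  have -> : 1 - (f u * v u) ^+ 2 = (f u / S u) ^+ 2.
    have -> : f u * v u = c / S u by rewrite /v; field; rewrite !gt_eqF.
    rewrite !expr_div_n S2; field; rewrite -S2 expf_neq0// gt_eqF//.
  by rewrite sqrtr_sqr ger0_norm// divr_ge0// ltW.
split=> //; apply/eqP; rewrite eq_le Hle andbT.
have E0 : 0 <= E t - E s.
  rewrite -(subrr (0 : R)).
  refine (@derive_le_incr _ (fun=> 0) (fun=> 0) E (fun u => f u / S u) s t (ltW st) _ _ _).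
  - by move=> u /sub/dE.
  - by move=> u /sub/fS[f0 S0 _ _]; exact: (divr_ge0 (ltW f0) (ltW S0)).
apply: (tsep_le dm W (c := c) (G := fun u => E u + c * B u)) => //; last first.
  by rewrite dxy; lra.
move=> u /sub uq; have [f0 S0 cltS S2] := fS u uq.
have -> : Num.sqrt (1 + (c / f u) ^+ 2) = f u / S u + c * v u.
  have -> : f u / S u + c * v u = S u / f u.
    have -> : f u / S u + c * v u = ((f u) ^+ 2 + c ^+ 2) / (f u * S u).
      by rewrite /v; field; rewrite !gt_eqF.
    by rewrite -S2; field; rewrite !gt_eqF.
  have -> : 1 + (c / f u) ^+ 2 = (S u / f u) ^+ 2.
    by rewrite !expr_div_n S2; field; rewrite gt_eqF.
  by rewrite sqrtr_sqr ger0_norm// divr_ge0// ltW.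
by apply: is_deriveD; [exact: dE|apply: is_deriveZ; exact: dB].
Qed.

End SeparationExpansion.

(** * The model space *)

Section Model.
Variables (R : realType).

Lemma window_exists (I : set R) (f : R -> R) (p q : R) : p <= q ->
  (forall u, p <= u <= q -> [/\ I u, 0 < f u & {for u, continuous f}]) ->
  exists b, window I f p q b.
Proof.
move=> pq H.
have [|c] := @EVT_min R f p q pq.
  by apply: continuous_in_subspaceT => u; rewrite inE/= in_itv/= => /H[].
rewrite in_itv/= => /H[_ fc0 _] fcle; exists (f c); split => // u uq.
by have [? _ ?] := H u uq; split => //; apply: fcle; rewrite in_itv/=.
Qed.

(** On [[0, T]] both [G u] and [- G (- u)] are antiderivatives of [g]. *)
Lemma even_antiderivative (g G : R -> R) (T : R) : 0 <= T ->
  (forall u, - T <= u <= T -> is_derive u 1 G (g u)) ->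
  (forall u, g (- u) = g u) -> G T - G 0 = G 0 - G (- T).
Proof.
move=> T0 dG ge.
have dH u : 0 <= u <= T -> is_derive u 1 (fun u => - G (- u)) (g u).
  move=> /andP[u0 uT].
  have Hu : is_derive (- u) 1 G (g u) by rewrite -ge; apply: dG; apply/andP; split; lra.
  apply: is_derive_eq (is_derive_opp (is_derive_comp (is_derive_opp (is_derive_id u 1)) Hu)) _.
  by rewrite mulrN1 opprK.
have dG' u : 0 <= u <= T -> is_derive u 1 G (g u).
  by move=> /andP[u0 uT]; apply: dG; apply/andP; split; lra.
have L1 := derive_le_incr T0 dG' dH (fun u _ => lexx _).
have L2 := derive_le_incr T0 dH dG' (fun u _ => lexx _).
rewrite oppr0 in L1 L2; lra.
Qed.

Lemma model_dist_metric : is_metric (@model_dist R).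
Proof.
split; first by move=> x y; exact: normr_ge0.
split.
  move=> x y; split=> [/eqP|->]; rewrite /model_dist ?subrr ?normr0//.
  by rewrite normr_eq0 subr_eq0 => /eqP.
split; first by move=> x y; exact: distrC.
by move=> x y z; exact: ler_distD.
Qed.

Lemma model_dist_geodesic : geodesic_space (@model_dist R).
Proof.
move=> x y; have [xy|/ltW yx] := leP x y.
  exists (fun t => x + t); rewrite /model_dist distrC ger0_norm ?subr_ge0// addr0 subrKC.
  split=> //; split=> // s t _ _.
  by congr `| _ |; ring.
exists (fun t => x - t); rewrite /model_dist ger0_norm ?subr_ge0// subr0 subKr.
split=> //; split=> // s t _ _.
by rewrite -normrN; congr `| _ |; ring.
Qed.

Section SymmetricPoint.
Variables (I : set R) (w : R -> R) (r b : R).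
Hypothesis W : window I w (- r) r b.
Hypothesis w_even : forall u, w (- u) = w u.

Let S c u := Num.sqrt ((w u) ^+ 2 + c ^+ 2).

Let wS c u : - r <= u <= r -> 0 <= c ->
  [/\ b <= w u, w u <= S c u, 0 < w u, c <= S c u & (S c u) ^+ 2 = (w u) ^+ 2 + c ^+ 2].
Proof.
have [b0 Wp] := W; move=> /Wp[_ bw _] c0; have w0 := lt_le_trans b0 bw.
have w2 : 0 <= (w u) ^+ 2 by exact: sqr_ge0.
have c2 : 0 <= c ^+ 2 by exact: sqr_ge0.
split=> //.
- by rewrite -[leLHS](ger0_norm (ltW w0)) -sqrtr_sqr ler_sqrt; lra.
- by rewrite -[leLHS](ger0_norm c0) -sqrtr_sqr ler_sqrt; lra.
- by rewrite sqr_sqrtr//; lra.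
Qed.

Let antiderivatives c : 0 <= r -> 0 <= c -> exists BE : (R -> R) * (R -> R),
  (forall u, - r <= u <= r -> is_derive u 1 BE.1 (c / (w u * S c u))) /\
  (forall u, - r <= u <= r -> is_derive u 1 BE.2 (w u / S c u)).
Proof.
move=> r0 c0; have [b0 Wp] := W.
have rr : - r <= r by lra.
have cS u : - r <= u <= r -> {for u, continuous (S c)}.
  move=> /Wp[_ _ cf].
  apply: continuous_sqrt.
  apply: continuousD; last exact: cvg_cst.
  exact: continuous_sqr.
have [|B dB] := @antiderivative R (fun u => c / (w u * S c u)) _ _ rr.
  move=> u uq; have [_ _ cw] := Wp u uq; have [_ wSu w0 _ _] := wS uq c0.
  apply: continuousM; first exact: cvg_cst.
  apply: continuousV; first by rewrite mulf_neq0// gt_eqF// (lt_le_trans w0).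
  by apply: continuousM => //; exact: cS.
have [|E dE] := @antiderivative R (fun u => w u / S c u) _ _ rr.
  move=> u uq; have [_ _ cw] := Wp u uq; have [_ wSu w0 _ _] := wS uq c0.
  apply: continuousM => //; apply: continuousV; last exact: cS.
  by rewrite gt_eqF// (lt_le_trans w0).
by exists (B, E).
Qed.

(* The geodesics of momentum [c] from [(-T, 0)] to [(0, m)] and from [(0, m)] to
   [(T, 0)] have the same length, which depends continuously on [c]. *)
Lemma symmetric_point (T e : R) : 0 < T -> T <= r -> 0 < e ->
  exists2 ga, 0 < ga & forall a, T - ga <= a -> a <= T -> exists2 m, 0 <= m < e &
    tsep (@model_dist R) I w (- T, 0) (0, m) = a%:E /\
    tsep (@model_dist R) I w (0, m) (T, 0) = a%:E.
Proof.
move=> T0 Tr e0; have [b0 Wp] := W.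
have r0 : 0 <= r by lra.
(* The antiderivatives are chosen as functions of the momentum; negative momenta get a dummy
   value. *)
have /choice[F FP] : forall c, exists BE : (R -> R) * (R -> R), 0 <= c ->
  (forall u, - r <= u <= r -> is_derive u 1 BE.1 (c / (w u * S c u))) /\
  (forall u, - r <= u <= r -> is_derive u 1 BE.2 (w u / S c u)).
  move=> c; have [c0|c0] := leP 0 c; first by have [BE H] := antiderivatives r0 c0; exists BE.
  by exists (id, id).
pose B c := (F c).1; pose E c := (F c).2.
have dB c u : 0 <= c -> - r <= u <= r -> is_derive u 1 (B c) (c / (w u * S c u)).
  by move=> /FP[H _]; exact: H.
have dE c u : 0 <= c -> - r <= u <= r -> is_derive u 1 (E c) (w u / S c u).
  by move=> /FP[_ H]; exact: H.
pose bb c := B c 0 - B c (- T); pose ee c := E c 0 - E c (- T).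
have Tr' u : - T <= u <= T -> - r <= u <= r.
  by move=> /andP[? ?]; apply/andP; split; lra.
have T0' u : - T <= u <= 0 -> - r <= u <= r.
  by move=> /andP[? ?]; apply/andP; split; lra.
have NT0 : - T <= 0 by lra.
have NT0' : - T < 0 by lra.
have S_even c u : S c (- u) = S c u by rewrite /S w_even.
have Bsym c : 0 <= c -> B c T - B c 0 = bb c.
  move=> c0; apply: (@even_antiderivative (fun u => c / (w u * S c u))) => //; first exact: ltW.
    by move=> u /Tr'; exact: dB.
  by move=> u; rewrite w_even S_even.
have Esym c : 0 <= c -> E c T - E c 0 = ee c.
  move=> c0; apply: (@even_antiderivative (fun u => w u / S c u)) => //; first exact: ltW.
    by move=> u /Tr'; exact: dE.
  by move=> u; rewrite w_even S_even.
have tauE c : 0 <= c -> 0 <= bb c ->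
    tsep (@model_dist R) I w (- T, 0) (0, bb c) = (ee c)%:E /\
    tsep (@model_dist R) I w (0, bb c) (T, 0) = (ee c)%:E.
  move=> c0 bb0.
  have NrT : - r <= - T by lra.
  have dB' u : - r <= u <= r -> is_derive u 1 (B c) (c / (w u * S c u)) by exact: dB.
  have dE' u : - r <= u <= r -> is_derive u 1 (E c) (w u / S c u) by exact: dE.
  have [|_ _ ->] := tsep_momentum model_dist_metric model_dist_geodesic W
    (x := 0) (y := bb c) NrT NT0' r0 c0 dB' dE'.
    by rewrite /model_dist sub0r normrN ger0_norm.
  have Nr0 : - r <= 0 by lra.
  have [|_ _ ->] := tsep_momentum model_dist_metric model_dist_geodesic W
    (x := bb c) (y := 0) Nr0 T0 Tr c0 dB' dE'.
    by rewrite /model_dist subr0 ger0_norm// Bsym.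
  by rewrite Esym.
have bb_le c : 0 <= c -> 0 <= bb c <= c * b ^- 2 * T.
  move=> c0; have kb u : - r <= u <= r -> 0 <= c / (w u * S c u) <= c * b ^- 2.
    move=> uq; have [bw wSu w0 _ _] := wS uq c0.
    have Su0 := lt_le_trans w0 wSu.
    have ws0 : 0 < w u * S c u by rewrite mulr_gt0.
    rewrite divr_ge0 ?(ltW ws0)//= ler_wpM2l// lef_pV2 ?posrE ?exprn_gt0//.
    by rewrite expr2 ler_pM// ?(ltW b0)// (le_trans bw).
  apply/andP; split.
    rewrite -[leLHS](subrr (0 : R)).
    refine (@derive_le_incr _ (fun=> 0) (fun=> 0) (B c) (fun u => c / (w u * S c u)) _ _ NT0 _ _ _).
      by move=> u /T0'; exact: dB.
    by move=> u /T0'/kb/andP[].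
  have -> : c * b ^- 2 * T = c * b ^- 2 * 0 - c * b ^- 2 * - T by ring.
  refine (@derive_le_incr _ (B c) (fun u => c / (w u * S c u)) (fun u => c * b ^- 2 * u)
    (fun=> c * b ^- 2) _ _ NT0 _ _ _).
  - by move=> u /T0'; exact: dB.
  - move=> u _; apply: is_derive_eq (is_derive_scale _ (is_derive_id u 1)) _.
    by rewrite mulr1.
  - by move=> u /T0'/kb/andP[].
(* The integrands differ by [(S c' - S c) w / (S c S c')], where [S] is 1-Lipschitz in the momentum
   and the other factor is at most [1 / b]. *)
have ee_lip c c' : 0 <= c -> 0 <= c' -> ee c - ee c' <= b^-1 * T * `|c - c'|.
  move=> c0 c'0.
  suff : ee c - ee c' <= (b^-1 * `|c - c'|) * 0 - (b^-1 * `|c - c'|) * - T by lra.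
  have -> : ee c - ee c' = (E c 0 - E c' 0) - (E c (- T) - E c' (- T)) by rewrite /ee; ring.
  refine (@derive_le_incr _ (fun u => E c u - E c' u) (fun u => w u / S c u - w u / S c' u)
    (fun u => b^-1 * `|c - c'| * u) (fun=> b^-1 * `|c - c'|) _ _ NT0 _ _ _).
  - by move=> u /T0' uq; apply: is_derive_sub; exact: dE.
  - move=> u _; apply: is_derive_eq (is_derive_scale _ (is_derive_id u 1)) _.
    by rewrite mulr1.
  move=> u /T0' uq.
  have [bw wSu w0 cS SE] := wS uq c0; have [_ wSu' _ cS' SE'] := wS uq c'0.
  have S0 := lt_le_trans w0 wSu; have S0' := lt_le_trans w0 wSu'.
  set n := `|c - c'|.
  have n0 : 0 <= n by exact: normr_ge0.
  have SS : S c' u - S c u <= n.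
    rewrite leNgt; apply/negP => Sn.
    have : n * (S c' u + S c u) < (S c' u - S c u) * (S c' u + S c u).
      by rewrite ltr_pM2r// addr_gt0.
    have -> : (S c' u - S c u) * (S c' u + S c u) = (c' - c) * (c' + c).
      have -> : (S c' u - S c u) * (S c' u + S c u) = S c' u ^+ 2 - S c u ^+ 2 by ring.
      by rewrite SE SE'; ring.
    apply/negP; rewrite -leNgt.
    apply: (@le_trans _ _ (n * (c' + c))).
      by rewrite ler_wpM2r ?addr_ge0// /n distrC ler_norm.
    by rewrite ler_wpM2l// lerD.
  have -> : w u / S c u - w u / S c' u = (S c' u - S c u) * (w u / S c u / S c' u).
    by field; rewrite !gt_eqF.
  have q1 : 0 <= w u / S c u / S c' u <= b^-1.
    rewrite !divr_ge0 ?(ltW w0) ?(ltW S0) ?(ltW S0')//= -[leRHS]mul1r.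
    apply: ler_pM; rewrite ?divr_ge0 ?invr_ge0 ?(ltW w0) ?(ltW S0) ?(ltW S0')//.
      by rewrite ler_pdivrMr ?mul1r.
    by rewrite lef_pV2 ?posrE// (le_trans bw).
  case/andP: q1 => q0 q1.
  apply: (@le_trans _ _ (n * (w u / S c u / S c' u))); first by rewrite ler_wpM2r.
  by rewrite mulrC ler_wpM2r.
have ee0 : ee 0 = T.
  have E0 u : - r <= u <= r -> w u / S 0 u = 1.
    move=> uq; have [_ _ w0 _ _] := wS uq (lexx 0).
    by rewrite /S expr0n addr0 sqrtr_sqr gtr0_norm// divff// gt_eqF.
  have dE0 u : - T <= u <= 0 -> is_derive u 1 (E 0) 1.
    by move=> /T0' uq; exact: is_derive_eq (dE 0 u (lexx _) uq) (E0 u uq).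
  have L1 := derive_le_incr NT0 dE0 (fun u _ => is_derive_id u 1) (fun u _ => lexx _).
  have L2 := derive_le_incr NT0 (fun u _ => is_derive_id u 1) dE0 (fun u _ => lexx _).
  by rewrite /ee; move: L1 L2; lra.
(* By [bb_le] momenta up to [c0] displace by at most [e / 2]. *)
pose c0 := e * b ^+ 2 / (2 * T).
have c00 : 0 < c0 by rewrite divr_gt0 ?mulr_gt0 ?exprn_gt0.
have eec0 : ee c0 < T.
  rewrite -ee0.
  refine (@derive_lt_incr _ (E c0) (fun u => w u / S c0 u)
    (E 0) (fun u => w u / S 0 u) _ _ NT0' _ _ _).
  - by move=> u /T0' uq; apply: dE => //; exact: ltW.
  - by move=> u /T0' uq; exact: dE.
  move=> u /andP[/ltW u1 /ltW u2]; have uq : - r <= u <= r by apply: T0'; rewrite u1 u2.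
  have [_ _ w0 _ _] := wS uq (lexx 0).
  have [_ wSu _ _ _] := wS uq (ltW c00).
  rewrite ltr_pM2l// ltf_pV2 ?posrE; last first.
    by rewrite /S expr0n addr0 sqrtr_sqr gtr0_norm.
    exact: lt_le_trans wSu.
  have c2 : 0 < c0 ^+ 2 by rewrite exprn_gt0.
  have w2 : 0 < (w u) ^+ 2 by rewrite exprn_gt0.
  by rewrite ltr_sqrt ?expr0n/= ?addr0 ?ltrDl// addr_gt0.
(* All lengths between [ee c0] and [ee 0 = T] occur for momenta in [[0, c0]]. *)
exists (T - ee c0) => [|a a1 a2]; first by rewrite subr_gt0.
have [|||c /andP[cl cr] cE] := @ivt_eps R (fun c => a - ee c) 0 c0 (ltW c00).
- move=> c /andP[cc0 cc1] ep ep0.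
  have k0 : 0 < b^-1 * T by rewrite mulr_gt0 ?invr_gt0.
  exists (ep / (b^-1 * T)); first by rewrite divr_gt0.
  move=> c' /andP[cc0' cc1']; rewrite ltr_pdivlMr// => H.
  have L1 := ee_lip c c' cc0 cc0'; have L2 := ee_lip c' c cc0' cc0.
  rewrite (distrC c' c) in L2.
  by rewrite ltr_norml; apply/andP; split; move: H L1 L2; lra.
- by rewrite ee0 subr_le0.
- by move: a1; lra.
have /andP[b1 b2] := bb_le c cl.
exists (bb c).
  rewrite b1; apply: le_lt_trans b2 _.
  apply: (@le_lt_trans _ _ (c0 * b ^- 2 * T)).
    by rewrite ler_wpM2r ?(ltW T0)// ler_wpM2r// invr_ge0 sqr_ge0.
  have -> : c0 * b ^- 2 * T = e / 2 by rewrite /c0; field; rewrite !gt_eqF.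
  by move: e0; lra.
have [-> ->] := tauE c cl b1.
have -> : ee c = a by move: cE; lra.
by [].
Qed.

End SymmetricPoint.

(** For [K < 0] half of the interval where the cosine is positive is taken; vertical segments of
    length below [2 r] then respect the size bound of the curvature condition. *)
Lemma model_warpP (K : R) : exists2 r, 0 < r &
  (K < 0 -> r < pi / (2 * Num.sqrt (- K))) /\
  (forall u, `|u| <= r -> model_interval K u /\ 0 < model_warp K u) /\
  (forall u, model_warp K (- u) = model_warp K u) /\
  exists dw : R -> R, forall u : R, is_derive u 1 (model_warp K) (dw u) /\
                       is_derive u 1 dw (K * model_warp K u).
Proof.
have [K0|K0|K0] := ltgtP K 0.
- have k0 : 0 < Num.sqrt (- K) by rewrite sqrtr_gt0 oppr_gt0.
  set k := Num.sqrt (- K) in k0 *.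
  have k2 : k ^+ 2 = - K by rewrite sqr_sqrtr// oppr_ge0 ltW.
  have wE : model_warp K = fun t => cos (k * t).
    by apply/funext => t; rewrite /model_warp ltNge (ltW K0)/= lt_eqF.
  have pi0 := pi_gt0 R.
  exists (pi / (2 * k) / 2); first by rewrite !divr_gt0// mulr_gt0.
  have rp : pi / (2 * k) / 2 < pi / (2 * k).
    by have : 0 < pi / (2 * k) by [rewrite divr_gt0// mulr_gt0]; lra.
  split=> //; split.
    move=> u ur; have ur' := le_lt_trans ur rp; split.
      by rewrite /model_interval leNgt K0.
    rewrite wE; apply: cos_gt0_pihalf.
    have : `|k * u| < pi / 2.
      rewrite normrM (gtr0_norm k0) -ltr_pdivlMl//.
      by rewrite (_ : k^-1 * (pi / 2) = pi / (2 * k))//; field; rewrite gt_eqF.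
    by rewrite ltr_norml.
  split; first by move=> u; rewrite wE mulrN cosN.
  exists (fun t => - k * sin (k * t)) => u; rewrite wE.
  have dk : is_derive u 1 (fun t => k * t) k.
    by apply: is_derive_eq (is_derive_scale k (is_derive_id u 1)) _; rewrite mulr1.
  split.
    apply: is_derive_eq (is_derive_comp dk (is_derive_cos (k * u))) _; ring.
  apply: is_derive_eq (is_derive_scale (- k) (is_derive_comp dk (is_derive_sin (k * u)))) _.
  have -> : K = - k ^+ 2 by rewrite k2 opprK.
  ring.
- have k2 : (Num.sqrt K) ^+ 2 = K by rewrite sqr_sqrtr// ltW.
  set k := Num.sqrt K in k2 *.
  have wE : model_warp K = fun t => (expR (k * t) + expR (- (k * t))) / 2.
    by apply/funext => t; rewrite /model_warp K0.
  exists 1 => //; split; first by [].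
  split.
    move=> u _; split; first by rewrite /model_interval ltW.
    by rewrite wE divr_gt0// addr_gt0// expR_gt0.
  split; first by move=> u; rewrite wE mulrN opprK addrC.
  exists (fun t => 2^-1 * (k * (expR (k * t) - expR (- (k * t))))) => u; rewrite wE.
  have dk : is_derive u 1 (fun t => k * t) k.
    by apply: is_derive_eq (is_derive_scale k (is_derive_id u 1)) _; rewrite mulr1.
  have de1 := is_derive_comp dk (is_derive_expR (k * u)).
  have de2 := is_derive_comp (is_derive_opp dk) (is_derive_expR (- (k * u))).
  split.
    rewrite (_ : (fun t => _) = (fun t => 2^-1 * (expR (k * t) + expR (- (k * t))))); last first.
      by apply/funext => t; rewrite mulrC.
    apply: is_derive_eq (is_derive_scale _ (is_derive_add de1 de2)) _; ring.
  apply: is_derive_eq (is_derive_scale _ (is_derive_scale k (is_derive_sub de1 de2))) _.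
  rewrite -[in RHS]k2; ring.
- have wE : model_warp K = fun=> 1.
    by apply/funext => t; rewrite /model_warp K0 ltxx eqxx.
  exists 1 => //; split; first by [].
  split; first by move=> u _; rewrite wE /model_interval K0 lexx.
  split; first by move=> u; rewrite wE.
  exists (fun=> 0) => u; rewrite wE K0 mul0r; split; exact: is_derive_cst.
Qed.

End Model.

(** * Triangle comparison *)

Section TriangleComparison.
Variables (R : realType) (X : Type) (d : X -> X -> R) (I : set R) (f : R -> R) (K : R).
Hypothesis dm : is_metric d.
Variables (x1 : X) (t0 r bf bw : R).
Hypothesis rK : K < 0 -> r < pi / (2 * Num.sqrt (- K)).
Hypothesis Wf : window I f (t0 - r) (t0 + r) bf.
Hypothesis Ww : window (model_interval K) (model_warp K) (- r) r bw.

Let tau := tsep d I f.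
Let taum := model_tsep K.

(** The two short sides are arbitrary maximizers supplied by the neighborhood, as only their lengths
    matter. The long side is vertical and explicit, which locates [p] and its counterpart. *)
Lemma triangle_comparison (lower : bool) (U : set (R * X)) (T s1 a m Ra Rb : R) (x2 : X) :
  0 < T -> T < r ->
  (forall p q, U p -> U q -> tl_rel d I f p q -> exists g, max_side d I f U p q g) ->
  (forall x y z, U x -> U y -> U z -> tl_rel d I f x y -> tl_rel d I f y z ->
     (tau x z < +oo)%E ->
     (K < 0 -> (tau x z < (pi / Num.sqrt (- K))%:E)%E) ->
     forall gxy gyz gxz,
       max_side d I f U x y gxy -> max_side d I f U y z gyz ->
       max_side d I f U x z gxz ->
     forall x' y' z' : R * R, model_pt K x' -> model_pt K y' -> model_pt K z' ->
       taum x' y' = tau x y -> taum y' z' = tau y z -> taum x' z' = tau x z ->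
     forall p p' q q', tri_pt d I f K x y z gxy gyz gxz x' y' z' p p' ->
       tri_pt d I f K x y z gxy gyz gxz x' y' z' q q' ->
       if lower then (tau p q <= taum p' q')%E else (taum p' q' <= tau p q)%E) ->
  (forall u, t0 - T <= u <= t0 + T -> U (u, x1)) -> U (s1, x2) ->
  tl_rel d I f (t0 - T, x1) (s1, x2) -> tl_rel d I f (s1, x2) (t0 + T, x1) ->
  c_rel (@model_dist R) (model_interval K) (model_warp K) (- T, 0) (0, m) ->
  tau (t0 - T, x1) (s1, x2) = a%:E -> tau (s1, x2) (t0 + T, x1) = a%:E ->
  taum (- T, 0) (0, m) = a%:E -> taum (0, m) (T, 0) = a%:E ->
  tau (t0 - T / 2, x1) (s1, x2) = Ra%:E -> taum (- (T / 2), 0) (0, m) = Rb%:E ->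
  if lower then Ra <= Rb else Rb <= Ra.
Proof.
move=> T0 Tr Umax Utri Uv Uy txy tyz cxy' axy ayz axy' ayz' RaE RbE.
have Ux : U (t0 - T, x1) by apply: Uv; apply/andP; split; lra.
have Uz : U (t0 + T, x1) by apply: Uv; apply/andP; split; lra.
have [gxy mxy] := Umax _ _ Ux Uy txy; have [gyz myz] := Umax _ _ Uy Uz tyz.
have vY s t : t0 - T <= s -> s < t -> t <= t0 + T ->
    [/\ forall tl, fd_curve d I f tl (s, x1) (t, x1) (vertical_curve s t x1),
      curve_length d f (vertical_curve s t x1) = (t - s)%:E &
      tsep d I f (s, x1) (t, x1) = (t - s)%:E].
  by move=> ? ? ?; apply: (vertical_curveP dm Wf) => //; lra.
have vM s t : - T <= s -> s < t -> t <= T ->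
    [/\ forall tl, fd_curve (@model_dist R) (model_interval K) (model_warp K) tl
                     (s, 0) (t, 0) (vertical_curve s t 0),
      curve_length (@model_dist R) (model_warp K) (vertical_curve s t 0) = (t - s)%:E &
      taum (s, 0) (t, 0) = (t - s)%:E].
  by move=> ? ? ?; apply: (vertical_curveP (model_dist_metric R) Ww) => //; lra.
have mpt u c : - T <= u -> u <= T -> model_pt K (u, c).
  by move=> ? ?; have [_ H] := Ww; have [] := H u; rewrite //; apply/andP; split; lra.
have l1 : - T <= - T by [].
have l2 : - T < - (T / 2) by lra.
have l3 : - (T / 2) <= T by lra.
have l4 : - T <= - (T / 2) by lra.
have l5 : - (T / 2) < T by lra.
have l6 : - T < T by lra.
have L1 : t0 - T <= t0 - T by [].
have L2 : t0 - T < t0 - T / 2 by lra.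
have L3 : t0 - T / 2 <= t0 + T by lra.
have L4 : t0 - T <= t0 - T / 2 by lra.
have L5 : t0 - T / 2 < t0 + T by lra.
have L6 : t0 - T < t0 + T by lra.
have [fdxz lenxz tauxz] := vY _ _ L1 L6 (lexx _).
have [fdxp _ tauxp] := vY _ _ L1 L2 L3.
have [fdpz _ taupz] := vY _ _ L4 L5 (lexx _).
have [fdxz' _ tauxz'] := vM _ _ l1 l6 (lexx _).
have [fdxp' _ tauxp'] := vM _ _ l1 l2 l3.
have [fdpz' _ taupz'] := vM _ _ l4 l5 (lexx _).
have mxz : max_side d I f U (t0 - T, x1) (t0 + T, x1) (vertical_curve (t0 - T) (t0 + T) x1).
  by split; [exact: fdxz|split; [exact: Uv|rewrite lenxz tauxz]].
have := Utri _ _ _ Ux Uy Uz txy tyz.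
rewrite /tau tauxz ltry => /(_ isT) H.
have {}H := H _ _ _ _ mxy myz mxz (- T, 0) (0, m) (T, 0).
have -> : (Ra <= Rb) = (tau ((t0 - T / 2)%R, x1) (s1, x2) <= taum ((- (T / 2))%R, 0%R) (0%R, m))%E.
  by rewrite RaE RbE lee_fin.
have -> : (Rb <= Ra) = (taum ((- (T / 2))%R, 0%R) (0%R, m) <= tau ((t0 - T / 2)%R, x1) (s1, x2))%E.
  by rewrite RaE RbE lee_fin.
apply: H.
- move=> K0; rewrite lte_fin; have := rK K0.
  have -> : pi / (2 * Num.sqrt (- K)) = pi / Num.sqrt (- K) / 2 by rewrite invfM mulrCA mulrC.
  lra.
- by apply: mpt; lra.
- by apply: mpt; lra.
- by apply: mpt; lra.
- by rewrite axy'.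
- by rewrite ayz'.
- by rewrite tauxz'; congr EFin; ring.
- right; right; split.
    by exists (t0 - T / 2); split=> //; apply/andP.
  split; first by apply: mpt.
  split; first by rewrite /tau tauxp -/taum tauxp'; congr EFin; ring.
  split; first by rewrite /tau taupz -/taum taupz'; congr EFin; ring.
  split; right; first by exists (vertical_curve (- T) (- (T / 2)) 0).
  by exists (vertical_curve (- (T / 2)) T 0).
(* The second point is the middle vertex, viewed as the end point of the first short side. *)
- left; split.
    have [[g01 [_ [g1 _]]] _] := mxy.
    by exists (cs1 gxy); split=> //; rewrite lexx ltW.
  split; first by apply: mpt; lra.
  split; first by rewrite -/taum axy'.
  (* No future directed curve returns to the time at which it starts, so both separations are 0. *)
  split; first by rewrite -/(tau _ _) /tau /model_tsep !tsep_eq0.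
  by split; [right|left].
Qed.

End TriangleComparison.

Lemma geodesic_points_at (R : realType) (X : Type) (d : X -> X -> R) (x y : X) (l : R) :
  geodesic_space d -> 0 < l -> l <= d x y -> exists z, d x z = l.
Proof.
move=> dgeo l0 ld; have [c [c0 [_ ciso]]] := dgeo x y.
exists (c l); rewrite -[in LHS]c0 ciso ?lexx ?(le_trans (ltW l0) ld) ?(ltW l0)//.
by rewrite sub0r normrN gtr0_norm.
Qed.

Lemma curvature_cross_ratio (R : realType) (X : Type) (d : X -> X -> R) (I : set R)
    (f : R -> R) (K : R) (x1 x1' : X) (t0 r bf bw : R) (A Am : R -> R)
    (lower : bool) :
  is_metric d -> geodesic_space d -> x1 <> x1' -> 0 < r ->
  (K < 0 -> r < pi / (2 * Num.sqrt (- K))) ->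
  window I f (t0 - r) (t0 + r) bf ->
  window (model_interval K) (model_warp K) (- r) r bw ->
  (forall u, model_warp K (- u) = model_warp K u) ->
  (forall u, t0 - r <= u <= t0 + r -> is_derive u 1 A ((f u) ^- 2)) ->
  (forall u, - r <= u <= r -> is_derive u 1 Am ((model_warp K u) ^- 2)) ->
  tl_curv_bound d I f lower K ->
  exists2 T, 0 < T < r &
  let al1 := (2 * (A t0 - A (t0 - T)))^-1 in
  let al2 := (2 * (A (t0 + T) - A t0))^-1 in
  let be := (2 * (A t0 - A (t0 - T / 2)))^-1 in
  let al1' := (2 * (Am 0 - Am (- T)))^-1 in
  let al2' := (2 * (Am T - Am 0))^-1 in
  let be' := (2 * (Am 0 - Am (- (T / 2))))^-1 in
  if lower then (al1 + al2) * (be' - al1') <= (al1' + al2') * (be - al1)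
  else (al1' + al2') * (be - al1) <= (al1 + al2) * (be' - al1').
Proof.
move=> dm dgeo x11' r0 rK Wf Ww w_even dA dAm curv; pose tau := tsep d I f.
have [d0 [deq [dsym dtri]]] := dm.
have dpos : 0 < d x1 x1'.
  by rewrite lt_neqAle d0 andbT eq_sym; apply/eqP => /deq.
have dxx : d x1 x1 = 0 by exact/deq.
have [_ Wf'] := Wf; have [_ Ww'] := Ww.
have It0 : I t0.
  by have [|? _ _] := Wf' t0; first by apply/andP; split; lra.
have [U [[rU [rU0 ballU]] [_ [Ufin [Ucont [Umax Utri]]]]]] := curv (t0, x1) It0.
(* Keeps the vertical side inside the window and inside [U]. *)
pose T := Num.min r rU / 2.
have m0 : 0 < Num.min r rU by rewrite lt_min r0.
have T0 : 0 < T by rewrite divr_gt0.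
have : T < Num.min r rU by rewrite /T; lra.
rewrite lt_min => /andP[Tr TrU].
exists T; first by rewrite T0.
move=> al1 al2 be al1' al2' be'.
have I1 : t0 - r < t0 - T by move: T0 Tr r0; clear; lra.
have I2 : t0 - T < t0 by move: T0 Tr r0; clear; lra.
have I3 : t0 < t0 + T by move: T0 Tr r0; clear; lra.
have I4 : t0 + T < t0 + r by move: T0 Tr r0; clear; lra.
have I5 : t0 - r < t0 - T / 2 by move: T0 Tr r0; clear; lra.
have I6 : t0 - T / 2 < t0 by move: T0 Tr r0; clear; lra.
have I7 : t0 < t0 + r by move: T0 Tr r0; clear; lra.
have J1 : - r < - T by move: T0 Tr r0; clear; lra.
have J2 : - T < 0 by move: T0 Tr r0; clear; lra.
have J4 : - r < - (T / 2) by move: T0 Tr r0; clear; lra.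
have J5 : - (T / 2) < 0 by move: T0 Tr r0; clear; lra.
have J6 : - r < 0 by move: T0 Tr r0; clear; lra.
have I8 : t0 - T < t0 - T / 2 by move: T0 Tr r0; clear; lra.
have J7 : - T < - (T / 2) by move: T0 Tr r0; clear; lra.
have I9 : t0 - T / 2 <= t0 + r by move: T0 Tr r0; clear; lra.
have J8 : - (T / 2) <= r by move: T0 Tr r0; clear; lra.
have gap (B : R -> R) s m t : 0 < B t - B m -> 0 < B m - B s ->
    0 <= (2 * (B t - B m))^-1 - (2 * (B t - B s))^-1.
  move=> h1 h2; have h3 : B s <= B m by move: h2; clear; lra.
  by rewrite subr_ge0 lef_pV2 ?posrE; move: h1 h2 h3; clear; lra.
have A1 := antideriv_gt0 Wf dA (ltW I1) I2 (ltW I7).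
have A2 := antideriv_gt0 Wf dA (ltW (lt_trans I1 I2)) I3 (ltW I4).
have A3 := antideriv_gt0 Wf dA (ltW I5) I6 (ltW I7).
have A4 := antideriv_gt0 Wf dA (ltW I1) I8 I9.
have M1 := antideriv_gt0 Ww dAm (ltW J1) J2 (ltW r0).
have M2 := antideriv_gt0 Ww dAm (ltW J6) T0 (ltW Tr).
have M3 := antideriv_gt0 Ww dAm (ltW J4) J5 (ltW r0).
have M4 := antideriv_gt0 Ww dAm (ltW J1) J7 J8.
have al10 : 0 < al1 by rewrite invr_gt0 mulr_gt0.
have al20 : 0 < al2 by rewrite invr_gt0 mulr_gt0.
have al10' : 0 < al1' by rewrite invr_gt0 mulr_gt0.
have al20' : 0 < al2' by rewrite invr_gt0 mulr_gt0.
have ga0 : 0 <= be - al1 by exact: gap.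
have ga0' : 0 <= be' - al1' by exact: gap.
have e00 : 0 < (al1 + al2) / 2 by rewrite divr_gt0// addr_gt0.
(* The same triangles serve both bounds. For the upper bound the two spaces exchange roles in
   [expansion_limit], which treats them symmetrically and only asks [u + mu] to be positive. The
   model vertex has time displacement 0. *)
suff claim : forall eta, 0 < eta -> eta < (al1 + al2) / 2 ->
    exists u mu dl P Q Ra Rb : R,
    [/\ 0 < u, 0 <= mu & if lower then Ra <= Rb else Rb <= Ra] /\
    [/\ `|P - (T + dl - u * al1)| <= eta * u,
        `|Q - (T - dl - u * al2)| <= eta * u &
        `|Ra - (T / 2 + dl - u * be)| <= eta * u] /\
    [/\ `|P - (T + 0 - mu * al1')| <= eta * mu,
        `|Q - (T - 0 - mu * al2')| <= eta * mu &
        `|Rb - (T / 2 + 0 - mu * be')| <= eta * mu].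
  case: lower curv Utri claim => _ _ claim.
    apply: (@expansion_limit R T (T / 2) ((al1 + al2) / 2)) => //; try exact: addr_gt0.
    move=> eta eta0 etae.
    have [u [mu [dl [P [Q [Ra [Rb H]]]]]]] := claim eta eta0 etae.
    have [[u0 mu0 Rab] [EY EM]] := H.
    exists u, mu, dl, 0, P, Q, Ra, Rb; split; last by [].
    by split; [exact: ltW|by []|exact: ltr_wpDr].
  apply: (@expansion_limit R T (T / 2) ((al1 + al2) / 2)) => //; try exact: addr_gt0.
  move=> eta eta0 etae.
    have [u [mu [dl [P [Q [Ra [Rb H]]]]]]] := claim eta eta0 etae.
    have [[u0 mu0 Rab] [EY EM]] := H.
  exists mu, u, 0, dl, P, Q, Rb, Ra; split; last by [].
  by split; [by []|exact: ltW|exact: ltr_wpDl].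
move=> eta eta0 etae.
have [e1 e10 EP] := tsep_expansion dm dgeo Wf dA I1 I2 I7 eta0.
have [e2 e20 EQ] := tsep_expansion dm dgeo Wf dA (lt_trans I1 I2) I3 I4 eta0.
have [e3 e30 ER] := tsep_expansion dm dgeo Wf dA I5 I6 I7 eta0.
have mdm := model_dist_metric R; have mdg := @model_dist_geodesic R.
have [f1 f10 MP] := tsep_expansion mdm mdg Ww dAm J1 J2 r0 eta0.
have [f2 f20 MQ] := tsep_expansion mdm mdg Ww dAm J6 T0 Tr eta0.
have [f3 f30 MR] := tsep_expansion mdm mdg Ww dAm J4 J5 r0 eta0.
have [|e e0 /= /and5P[ee1 ee2 ee3 ee4 /and5P[ee5 ee6 ee7 ee8 _]]] :=
    @pos_lower_bound R [:: e1; e2; e3; f1; f2; f3; rU / 2; r].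
  by rewrite /= e10 e20 e30 f10 f20 f30 divr_gt0// r0.
have [ga g0 sym] := symmetric_point Ww w_even T0 (ltW Tr) e0.
(* [C l^2] bounds the quadratic terms, errors included, of [P - Q] and of [2 (T - a)]. *)
pose C := al1 + al2 + 2 * eta.
have C0 : 0 < C by rewrite /C addr_gt0// ?mulr_gt0// addr_gt0.
(* [l] comes last, since [ga] depends on [e]. The bound [e / C] lets a shift of the vertex by
   [e / 2] outweigh the quadratic terms, and [2 ga / C] brings [a] into the range of
   [symmetric_point]. *)
have [|l l0 /= /and5P[l1 l2 l3 l4 /andP[l5 _]]] :=
    @pos_lower_bound R [:: e / 2; d x1 x1'; 1; e / C; 2 * ga / C].
  by rewrite /= dpos ltr01 !divr_gt0// mulr_gt0.
have [x2 dx2] := geodesic_points_at dgeo l0 l2.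
have dx2' : d x2 x1 = l by rewrite dsym.
have l20 : 0 < l ^+ 2 by rewrite exprn_gt0.
have ll : l ^+ 2 <= l by rewrite expr2 -[leRHS]mul1r ler_wpM2r// ltW.
have Ce : l ^+ 2 * C <= e by rewrite -ler_pdivlMr// (le_trans ll).
have Cg : l ^+ 2 * C <= 2 * ga by rewrite -ler_pdivlMr// (le_trans ll).
have le : l < e by move: l1 e0; clear; lra.
have e2e : e / 2 < e by move: e0; clear; lra.
have le1 := lt_le_trans le ee1; have le2 := lt_le_trans le ee2.
have le3 := lt_le_trans le ee3.
have P_at s : `|s - t0| <= e / 2 ->
  [/\ tl_rel d I f (t0 - T, x1) (s, x2) & exists2 v, tau (t0 - T, x1) (s, x2) = v%:E &
    `|v - (T + (s - t0) - l ^+ 2 * al1)| <= eta * l ^+ 2].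
  move=> st; have [||| tl _ [v vE vest]] := EP (t0 - T) s x1 x2.
  - by rewrite subrr normr0.
  - exact: le_lt_trans st (lt_le_trans e2e ee1).
  - by rewrite dx2.
  split=> //; exists v => //; move: vest; rewrite dx2 -/al1.
  by rewrite (_ : s - (t0 - T) = T + (s - t0)); last ring.
have Q_at s : `|s - t0| <= e / 2 ->
  [/\ tl_rel d I f (s, x2) (t0 + T, x1) & exists2 v, tau (s, x2) (t0 + T, x1) = v%:E &
    `|v - (T - (s - t0) - l ^+ 2 * al2)| <= eta * l ^+ 2].
  move=> st; have [||| tl _ [v vE vest]] := EQ s (t0 + T) x2 x1.
  - exact: le_lt_trans st (lt_le_trans e2e ee2).
  - by rewrite subrr normr0.
  - by rewrite dx2'.
  split=> //; exists v => //; move: vest; rewrite dx2' -/al2.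
  by rewrite (_ : t0 + T - s = T - (s - t0)); last ring.
have R_at s : `|s - t0| <= e / 2 -> exists2 v, tau (t0 - T / 2, x1) (s, x2) = v%:E &
    `|v - (T / 2 + (s - t0) - l ^+ 2 * be)| <= eta * l ^+ 2.
  move=> st; have [||| tl _ [v vE vest]] := ER (t0 - T / 2) s x1 x2.
  - by rewrite subrr normr0.
  - exact: le_lt_trans st (lt_le_trans e2e ee3).
  - by rewrite dx2.
  exists v => //; move: vest; rewrite dx2 -/be.
  by rewrite (_ : s - (t0 - T / 2) = T / 2 + (s - t0)); last ring.
have UI s y : `|s - t0| <= r -> `|s - t0| + d x1 y < rU -> U (s, y).
  move=> sr sU; apply: ballU => /=; last by rewrite /Dist /= distrC.
  have [|? _ _] := Wf' s; last by [].
  by move: sr; clear; rewrite ler_norml => /andP[? ?]; apply/andP; split; lra.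
have Uv u : t0 - T <= u <= t0 + T -> U (u, x1).
  move=> /andP[u1 u2]; have uT : `|u - t0| <= T.
    by move: u1 u2; clear; rewrite ler_norml => ? ?; apply/andP; split; lra.
  by apply: UI; [exact: le_trans uT (ltW Tr)|rewrite dxx addr0 (le_lt_trans uT)].
have eT : e / 2 <= r by move: e0 ee8; clear; lra.
have Us s : `|s - t0| <= e / 2 -> U (s, x2).
  move=> st; apply: UI; first exact: le_trans st eT.
  by rewrite dx2; move: st le e2e ee7 rU0; clear; lra.
have Ux : U (t0 - T, x1) by apply: Uv; move: T0; clear => ?; apply/andP; split; lra.
have Uz : U (t0 + T, x1) by apply: Uv; move: T0; clear => ?; apply/andP; split; lra.
pose F s := fine (tau (t0 - T, x1) (s, x2)) - fine (tau (s, x2) (t0 + T, x1)).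
have sE s : t0 - e / 2 <= s <= t0 + e / 2 -> `|s - t0| <= e / 2.
  by clear => /andP[? ?]; rewrite ler_norml; apply/andP; split; lra.
(* Shifting the vertex by [e / 2] in either direction changes the difference of the short sides by
   [e] to first order, enough to give it both signs. *)
have [s1 s1e F0] : exists2 s, t0 - e / 2 <= s <= t0 + e / 2 & F s = 0.
  apply: ivt_eps; first by move: e0; clear; lra.
  - move=> s /sE se h h0; have h2 : 0 < h / 2 by rewrite divr_gt0.
    have [q1 [q10 H1]] := Ucont _ _ Ux (Us s se) _ h2.
    have [q2 [q20 H2]] := Ucont _ _ (Us s se) Uz _ h2.
    exists (Num.min q1 q2); first by rewrite lt_min q10.
    move=> t /sE te; rewrite lt_min => /andP[st1 st2].
    have D0 y : Dist d y y = 0 by rewrite /Dist subrr normr0 add0r; exact/deq.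
    have Ds : Dist d (s, x2) (t, x2) = `|s - t|.
      by rewrite /Dist /= (_ : d x2 x2 = 0) ?addr0//; exact/deq.
    have := H1 _ _ Ux (Us t te); rewrite D0 Ds => /(_ q10 st1) {}H1.
    have := H2 _ _ (Us t te) Uz; rewrite D0 Ds => /(_ st2 q20) {}H2.
    move: H1 H2; rewrite /F !ltr_norml -!/tau => /andP[b1 b2] /andP[b3 b4].
    by move: b1 b2 b3 b4; clear => *; apply/andP; split; lra.
  - have E : `|t0 - e / 2 - t0| <= e / 2 by apply: sE; rewrite lexx/=; move: e0; clear; lra.
    have [_ [v vE]] := P_at _ E; have [_ [v' vE']] := Q_at _ E.
    rewrite /F vE vE' /= !ler_norml => /andP[a1 a2] /andP[a3 a4].
    have : 0 <= l ^+ 2 * al1 by exact: mulr_ge0 (ltW l20) (ltW al10).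
    by move: Ce a1 a2 a3 a4; rewrite /C !mulrDr; clear; lra.
  - have E : `|t0 + e / 2 - t0| <= e / 2 by apply: sE; rewrite lexx andbT; move: e0; clear; lra.
    have [_ [v vE]] := P_at _ E; have [_ [v' vE']] := Q_at _ E.
    rewrite /F vE vE' /= !ler_norml => /andP[a1 a2] /andP[a3 a4].
    have : 0 <= l ^+ 2 * al2 by exact: mulr_ge0 (ltW l20) (ltW al20).
    by move: Ce a1 a2 a3 a4; rewrite /C !mulrDr; clear; lra.
have {}s1e := sE _ s1e.
have [tlP [a aE estP]] := P_at _ s1e; have [tlQ [a' aE' estQ]] := Q_at _ s1e.
have [Ra RaE estR] := R_at _ s1e.
have aa' : a' = a by move: F0; rewrite /F aE aE' /=; clear; lra.
rewrite {a'}aa' in aE' estQ.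
(* Averaging the two estimates gives [a = T - l^2 (al1 + al2) / 2] up to [eta l^2]; the upper bound
   on [eta] yields [a <= T]. *)
have [aT1 aT2] : T - ga <= a /\ a <= T.
  have E0 : 0 <= l ^+ 2 * (al1 + al2 - 2 * eta).
    by rewrite mulr_ge0 ?(ltW l20)//; move: etae; clear; lra.
  move: estP estQ Cg E0; rewrite /C !ler_norml => /andP[q1 q2] /andP[q3 q4].
  by rewrite mulrBr !mulrDr; move: q1 q2 q3 q4; clear => *; split; lra.
have [m /andP[m0' me] [m1 m2]] := sym a aT1 aT2.
have dm1 : model_dist 0 m = m by rewrite /model_dist sub0r normrN ger0_norm.
have dm2 : model_dist m 0 = m by rewrite /model_dist subr0 ger0_norm.
have [||| _ crP [v vE MPe]] := MP (- T) 0 0 m; rewrite ?subrr ?normr0 ?dm1//.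
  exact: lt_le_trans me ee4.
have [||| _ _ [v' vE' MQe]] := MQ 0 T m 0; rewrite ?subrr ?normr0 ?dm2//.
  exact: lt_le_trans me ee5.
have [||| _ _ [Rb RbE MRe]] := MR (- (T / 2)) 0 0 m; rewrite ?subrr ?normr0 ?dm1//.
  exact: lt_le_trans me ee6.
have va : v = a by move: vE; rewrite m1 => -[].
have va' : v' = a by move: vE'; rewrite m2 => -[].
rewrite va dm1 -/al1' in MPe; rewrite va' dm2 -/al2' in MQe; rewrite dm1 -/be' in MRe.
exists (l ^+ 2), (m ^+ 2), (s1 - t0), a, a, Ra, Rb; split; last split.
- split; [by []|exact: sqr_ge0|].
  apply: (triangle_comparison dm rK Wf Ww T0 Tr Umax Utri Uv (Us _ s1e)
    tlP tlQ crP aE aE' m1 m2 RaE RbE).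
- by [].
- move: MPe MQe MRe; rewrite !sub0r !opprK !subr0 !addr0; by [].
Qed.

(** * From cross ratios to the sign of [f'' - K f] *)

Lemma open_ereal_interval (R : realType) (a b : \bar R) (t0 : R) : (a < t0%:E < b)%E ->
  exists2 r, 0 < r & forall t, `|t - t0| <= r -> (a < t%:E < b)%E.
Proof.
move=> /andP[at0 t0b].
have [r1 r10 H1] : exists2 r, 0 < r & forall t, t0 - r <= t -> (a < t%:E)%E.
  case: a at0 => [a|//|]; last by exists 1 => // t _; rewrite ltNyr.
  rewrite lte_fin => at0; exists ((t0 - a) / 2); first by rewrite divr_gt0// subr_gt0.
  by move=> t tt; rewrite lte_fin; lra.
have [r2 r20 H2] : exists2 r, 0 < r & forall t, t <= t0 + r -> (t%:E < b)%E.
  case: b t0b => [b||//]; last by exists 1 => // t _; rewrite ltry.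
  rewrite lte_fin => t0b; exists ((b - t0) / 2); first by rewrite divr_gt0// subr_gt0.
  by move=> t tt; rewrite lte_fin; lra.
exists (Num.min r1 r2); first by rewrite lt_min r10.
move=> t; rewrite le_min !ler_norml => /andP[/andP[? ?] /andP[? ?]].
by rewrite H1 ?H2//; lra.
Qed.

Lemma curvature_sign (R : realType) (X : Type) (d : X -> X -> R) (a b : \bar R)
    (f : R -> R) (K t0 : R) (lower : bool) :
  is_metric d -> geodesic_space d -> (exists x1 x2 : X, x1 <> x2) ->
  (forall t : R, (a < t%:E < b)%E -> 0 < f t) ->
  smooth_on [set t : R | (a < t%:E < b)%E] f ->
  tl_curv_bound d [set t : R | (a < t%:E < b)%E] f lower K ->
  (a < t0%:E < b)%E ->
  let g t := derive1n 2 f t - K * f t in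
  ~ (if lower then 0 < g t0 else g t0 < 0).
Proof.
move=> dm dgeo [x1 [x1' x11']] f0 smooth curv It0 g gt0.
set I := [set t : R | (a < t%:E < b)%E] in smooth curv.
have dn n t : I t -> is_derive t 1 (derive1n n f) (derive1n n.+1 f t).
  by move=> /(smooth n) H; rewrite /= derive1E; exact: DeriveDef.
have [r1 r10 H1] := open_ereal_interval It0.
have dg : {for t0, continuous g}.
  apply: is_derive_continuous.
  exact: is_derive_sub (dn 2 t0 It0) (is_derive_scale K (dn 0 t0 It0)).
(* Sturm comparison needs the strict sign on a whole window, where continuity provides it. *)
have [r2 r20 H2] : exists2 r, 0 < r & forall t, `|t - t0| <= r ->
    if lower then 0 < g t else g t < 0.
  have e0 : 0 < `|g t0|.
    by rewrite normr_gt0; case: (lower) gt0 => h; [rewrite gt_eqF|rewrite lt_eqF].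
  have /cvgrPdist_lt/(_ _ e0)[dl /= dl0 H] := dg.
  exists (dl / 2); first by rewrite divr_gt0.
  move=> t tt; have {}H : `|g t0 - g t| < `|g t0|.
    by apply: H; rewrite /ball_/= distrC; apply: le_lt_trans tt _; lra.
  move: H; case: (lower) gt0 => h.
    by rewrite (gtr0_norm h) ltr_norml => /andP[_]; lra.
  by rewrite (ltr0_norm h) ltr_norml => /andP[]; lra.
have [r3 r30 [rK [Hw [weven [dw dwP]]]]] := model_warpP K.
pose r := Num.min r1 (Num.min r2 r3).
have r0 : 0 < r by rewrite !lt_min r10 r20.
have [rr1 rr2 rr3] : [/\ r <= r1, r <= r2 & r <= r3].
  by split; rewrite /r !ge_min lexx ?orbT.
have rn u : t0 - r <= u <= t0 + r -> `|u - t0| <= r.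
  by move=> /andP[? ?]; rewrite ler_norml; apply/andP; split; lra.
have Iu u : t0 - r <= u <= t0 + r -> I u by move=> /rn/le_trans/(_ rr1)/H1.
have [||bf Wf] := @window_exists R I f (t0 - r) (t0 + r); first by lra.
  move=> u /Iu uI; split=> //; first exact: f0.
  exact: is_derive_continuous (dn 0 u uI).
have rn' u : - r <= u <= r -> `|u| <= r3.
  by move=> ur; apply: le_trans rr3; rewrite ler_norml.
have [||bw Ww] := @window_exists R (model_interval K) (model_warp K) (- r) r; first by lra.
  move=> u /rn'/Hw[? ?]; split=> //.
  by have [D _] := dwP u; exact: is_derive_continuous D.
have inv2 (h : R -> R) u : 0 < h u -> {for u, continuous h} ->
    {for u, continuous (fun t => (h t) ^- 2)}.
  move=> hu ch; apply: continuousV; first by rewrite expf_neq0// gt_eqF.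
  exact: continuous_sqr.
have [||A dA] := @antiderivative R (fun u => (f u) ^- 2) (t0 - r) (t0 + r); first by lra.
  move=> u /Iu uI; apply: inv2; first exact: f0.
  exact: is_derive_continuous (dn 0 u uI).
have [||Am dAm] := @antiderivative R (fun u => (model_warp K u) ^- 2) (- r) r; first by lra.
  move=> u /rn'/Hw[_ ?]; apply: inv2 => //.
  by have [D _] := dwP u; exact: is_derive_continuous D.
have rK' : K < 0 -> r < pi / (2 * Num.sqrt (- K)) by move=> /rK; exact: le_lt_trans.
have [T /andP[T0 Tr]] := curvature_cross_ratio dm dgeo x11' r0 rK' Wf Ww weven dA dAm curv.
move=> /=.
(* The model is symmetric about time 0; translation by [t0] puts both equations on one interval. *)
pose f2 u := model_warp K (u - t0); pose A2 u := Am (u - t0); pose df2 u := dw (u - t0).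
have shift u : t0 - r <= u <= t0 + r -> - r <= u - t0 <= r.
  by clear => /andP[? ?]; apply/andP; split; lra.
have dsh (h dh : R -> R) u : is_derive (u - t0) 1 h (dh (u - t0)) ->
    is_derive u 1 (fun v => h (v - t0)) (dh (u - t0)).
  move=> H; apply: is_derive_eq (is_derive_comp (is_derive_subr t0 (is_derive_id u 1)) H) _.
  by rewrite mulr1.
pose k u := derive1n 2 f u / f u.
have fpos u : t0 - r <= u <= t0 + r -> 0 < f u by move=> /Iu; exact: f0.
have dfP u : t0 - r <= u <= t0 + r -> is_derive u 1 f (derive1n 1 f u).
  by move=> /Iu; exact: (dn 0%N).
have ddfP u : t0 - r <= u <= t0 + r -> is_derive u 1 (derive1n 1 f) (k u * f u).
  by move=> uq; rewrite /k divfK; [exact: (dn 1%N) (Iu u uq)|rewrite gt_eqF// fpos].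
have f2pos u : t0 - r <= u <= t0 + r -> 0 < f2 u by move=> /shift/rn'/Hw[].
have df2P u : t0 - r <= u <= t0 + r -> is_derive u 1 f2 (df2 u).
  by move=> _; apply: dsh; have [] := dwP (u - t0).
have ddf2P u : t0 - r <= u <= t0 + r -> is_derive u 1 df2 (K * f2 u).
  by move=> _; apply: (dsh _ (fun v => K * model_warp K v)); have [] := dwP (u - t0).
have dA2 u : t0 - r <= u <= t0 + r -> is_derive u 1 A2 ((f2 u) ^- 2).
  by move=> /shift/dAm; exact: (dsh _ (fun v => (model_warp K v) ^- 2)).
have kK u : t0 - r <= u <= t0 + r -> if lower then K < k u else k u < K.
  move=> uq; have := H2 u (le_trans (rn u uq) rr2); have fu := fpos u uq.
  by case: (lower); rewrite /g /k ?ltr_pdivlMr ?ltr_pdivrMr// ?subr_gt0 ?subr_lt0.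
have O1 : t0 - r <= t0 - T by move: T0 Tr r0; clear; lra.
have O2 : t0 - T < t0 - T / 2 by move: T0 Tr r0; clear; lra.
have O3 : t0 - T / 2 < t0 by move: T0 Tr r0; clear; lra.
have O4 : t0 < t0 + T by move: T0 Tr r0; clear; lra.
have O5 : t0 + T <= t0 + r by move: T0 Tr r0; clear; lra.
have E1 : A2 t0 = Am 0 by rewrite /A2 subrr.
have E2 : A2 (t0 - T) = Am (- T) by rewrite /A2; congr Am; ring.
have E3 : A2 (t0 - T / 2) = Am (- (T / 2)) by rewrite /A2; congr Am; ring.
have E4 : A2 (t0 + T) = Am T by rewrite /A2; congr Am; ring.
rewrite -E1 -E2 -E3 -E4.
have inc (h B : R -> R) : (forall u, t0 - r <= u <= t0 + r -> 0 < h u) ->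
    (forall u, t0 - r <= u <= t0 + r -> is_derive u 1 B ((h u) ^- 2)) ->
    [/\ B (t0 - T) < B (t0 - T / 2), B (t0 - T / 2) < B t0 & B t0 < B (t0 + T)].
  by move=> h0 dB; split; apply: (antideriv_lt h0 dB) => //; move: T0 Tr r0; clear; lra.
have [i1 i2 i3] := inc _ _ fpos dA; have [j1 j2 j3] := inc _ _ f2pos dA2.
rewrite (cross_ratio_harmonic i1 i2 i3) (cross_ratio_harmonic j1 j2 j3).
pose ratio (B : R -> R) := (B (t0 + T) - B (t0 - T / 2)) * (B t0 - B (t0 - T)) /
  ((B t0 - B (t0 - T / 2)) * (B (t0 + T) - B (t0 - T))).
pose kap (B : R -> R) := (2 * (B t0 - B (t0 - T)))^-1 + (2 * (B (t0 + T) - B t0))^-1.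
rewrite -/(ratio A) -/(ratio A2) -!/(kap A) -!/(kap A2).
set rho := ratio A; set rho' := ratio A2; set ka := kap A; set ka' := kap A2.
have ka0 : 0 < ka.
  by rewrite addr_gt0// invr_gt0 mulr_gt0// subr_gt0// (lt_trans i1).
have ka0' : 0 < ka'.
  by rewrite addr_gt0// invr_gt0 mulr_gt0// subr_gt0// (lt_trans j1).
have kk : 0 < ka * ka' by exact: mulr_gt0.
have -> : ka * ((rho' - 1) * ka') = ka * ka' * (rho' - 1) by ring.
have -> : ka' * ((rho - 1) * ka) = ka * ka' * (rho - 1) by ring.
rewrite !(ler_pM2l kk) !lerD2r.
(* The larger coefficient has the larger Jacobi fields and hence the smaller cross ratio; which of
   the two functions plays that part depends on [lower]. *)
have cmp : if lower then rho < rho' else rho' < rho.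
  case: (lower) kK => kK.
    exact: (cross_ratio_lt fpos dfP ddfP dA f2pos df2P ddf2P dA2 kK O1 O2 O3 O4 O5).
  exact: (cross_ratio_lt f2pos df2P ddf2P dA2 fpos dfP ddfP dA kK O1 O2 O3 O4 O5).
by move: cmp; case: (lower) => ?; rewrite leNgt => /negP.
Qed.

Theorem theorem6p2 (R : realType) (X : Type) (d : X -> X -> R)
    (a b : \bar R) (f : R -> R) (K : R) :
  is_metric d -> geodesic_space d ->
  (exists x1 x2 : X, x1 <> x2) ->
  (a < b)%E ->
  (forall t : R, (a < t%:E < b)%E -> 0 < f t) ->
  smooth_on [set t : R | (a < t%:E < b)%E] f ->
  (tl_curv_bound d [set t : R | (a < t%:E < b)%E] f true K ->
     forall t : R, (a < t%:E < b)%E -> derive1n 2 f t - K * f t <= 0) /\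
  (tl_curv_bound d [set t : R | (a < t%:E < b)%E] f false K ->
     forall t : R, (a < t%:E < b)%E -> derive1n 2 f t - K * f t >= 0).
Proof.
move=> dm dgeo X2 _ f0 smooth; split=> curv t It.
  by rewrite leNgt; apply/negP; exact: (curvature_sign dm dgeo X2 f0 smooth curv It).
by rewrite leNgt; apply/negP; exact: (curvature_sign dm dgeo X2 f0 smooth curv It).
Qed.
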